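(* Let $(R,\mathfrak{m})$ be a Noetherian local ring with infinite residue field, let $\mathfrak{q}$ be an $\mathfrak{m}$-primary ideal of $R$, and let $\mathbb{M}=\{M_n\}_{n\ge 0}$ be a good $\mathfrak{q}$-filtration of a finitely generated $R$-module $M$ of dimension $d\ge 2$. Suppose $J$ is an ideal of $R$ generated by a maximal $\mathbb{M}$-superficial sequence for $\mathfrak{q}$ such that $\operatorname{depth} gr_{\mathbb{N}}(M)\ge d-1$, where $\mathbb{N}=\{J^nM\}_{n\ge0}$ is the $J$-adic filtration of $M$. Then $$e_2(\mathbb{M})-e_2(\mathbb{N})\le \sum_{n\ge 1} n\,\lambda(M_{n+1}/JM_n).$$
   Context: $\lambda(-)$ denotes length as an $R$-module. A $\mathfrak{q}$-filtration of $M$ is a chain of submodules $M=M_0\supseteq M_1\supseteq M_2\supseteq\cdots$ with $\mathfrak{q}M_n\subseteq M_{n+1}$ for all $n\ge 0$; it is good if $\mathfrak{q}M_n=M_{n+1}$ for all sufficiently large $n$. For a submodule $N\subseteq M$, $\mathbb{M}/N$ denotes the good $\mathfrak{q}$-filtration $\{(M_n+N)/N\}$ of $M/N$. Hilbert coefficients: the Hilbert function is $H_{\mathbb{M}}(n)=\lambda(M_n/M_{n+1})$ for $n\ge 0$, and the Hilbert series is $P_{\mathbb{M}}(t)=\sum_{n\ge0}H_{\mathbb{M}}(n)t^n=h_{\mathbb{M}}(t)/(1-t)^d$ with $h_{\mathbb{M}}(t)\in\mathbb{Z}[t]$, $h_{\mathbb{M}}(1)\ne0$, $d=\dim M$. For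 every $i\ge 0$, $e_i(\mathbb{M}):=h_{\mathbb{M}}^{(i)}(1)/i!$ (where $h_{\mathbb{M}}^{(i)}$ is the $i$-th derivative). The coefficients $e_i(\mathbb{N})$ are defined in the same way from the filtration $\mathbb{N}$, i.e. from $H_{\mathbb{N}}(n)=\lambda(J^nM/J^{n+1}M)$. Superficial sequences: an element $a\in\mathfrak{q}$ is $\mathbb{M}$-superficial for $\mathfrak{q}$ if there is an integer $c\ge 0$ such that $(M_{n+1}:_M a)\cap M_c=M_n$ for all $n\ge c$, where $N:_M a=\{x\in M: ax\in N\}$. A sequence $a_1,\dots,a_r$ is an $\mathbb{M}$-superficial sequence for $\mathfrak{q}$ if for each $i=1,\dots,r$ the element $a_i$ is $\mathbb{M}/(a_1,\dots,a_{i-1})M$-superficial for $\mathfrak{q}$. It is maximal if $r=d=\dim M$. The associated graded module is $gr_{\mathbb{N}}(M)=\bigoplus_{n\ge0}J^nM/J^{n+1}M$, a graded module over $gr_J(R)=\bigoplus_{n\ge0}J^n/J^{n+1}$; its depth is taken with respect to the homogeneous maximal ideal of $gr_J(R)$. *)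

(* Defs.v *)
From mathcomp Require Import all_boot all_order all_algebra.
From mathcomp Require Export boolp classical_sets cardinality fsbigop.

Set Implicit Arguments.
Unset Strict Implicit.
Unset Printing Implicit Defensive.

Import GRing.Theory.

Local Open Scope classical_set_scope.
Local Open Scope ring_scope.

(* The submodules and ideals of a module V, resp. of R, are sets V -> Prop;
   ideals are handled as submodules of R^o. A quotient A / B is never formed
   as a type: its elements are represented by elements of A, and its submodules
   by the submodules N of V such that B `<=` N `<=` A. *)

Section Submodules.
Context {R : comNzRingType}.
Implicit Types (V : lmodType R) (I : set R).

Definition submodule V (N : set V) : Prop := submod_closed [in N].

Definition span V (S : set V) : set V := smallest (@submodule V) S.

Definition ideal_span (S : set R) : set R := span (S : set R^o).

Definition fg_module V : Prop := exists s : seq V, span [set` s] = setT.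

Definition add_sub V (A B : set V) : set V := [set x + y | x in A & y in B].

Definition ideal_mul V I (N : set V) : set V :=
  span [set a *: x | a in I & x in N].

(* adic I V n = I^n V; in particular adic I R^o n = I^n. *)
Definition adic I V (n : nat) : set V := iter n (ideal_mul I) setT.

Definition annihilator V : set R := [set a | forall x : V, a *: x = 0].

(* Number of steps in the strictly increasing chains P_0 < ... < P_k in C. *)
Definition chain_lengths T (C : set (set T)) : set nat :=
  [set k | exists P : nat -> set T,
     (forall i, (i <= k)%N -> C (P i)) /\
     (forall i, (i < k)%N -> P i `<` P i.+1)].

(* The supremum is 0 by convention when there are arbitrarily long chains. *)

(* length of A / B, for submodules B `<=` A *)
Definition length V (A B : set V) : nat :=
  supremum 0%N
    (chain_lengths [set N | [/\ submodule N, B `<=` N & N `<=` A]]).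

Definition proper_idealr I : Prop := idealr_closed [in I].

Definition prime_idealr I : Prop :=
  proper_idealr I /\ prime_idealr_closed [in I].

(* Krull dimension of R / Ann V *)
Definition kdim V : nat :=
  supremum 0%N
    (chain_lengths [set P | prime_idealr P /\ annihilator V `<=` P]).

End Submodules.

Arguments fg_module {R} V.
Arguments adic {R} I V n.
Arguments annihilator {R} V.
Arguments kdim {R} V.

Section Rings.
Variable R : comNzRingType.
Implicit Types (I m q : set R).

Definition noetherian_ring : Prop :=
  forall I : set R, submodule (I : set R^o) ->
    exists s : seq R, ideal_span [set` s] = I.

Definition maximal_idealr I : Prop :=
  proper_idealr I /\ forall K, proper_idealr K -> I `<=` K -> K = I.

Definition local_ring m : Prop :=
  maximal_idealr m /\ forall I, maximal_idealr I -> I = m.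

(* R / m as the set of cosets of m *)
Definition residue_field m : set (set R) :=
  range (fun x : R => [set y | m (y - x)]).

Definition radical I : set R := [set x | exists n : nat, I (x ^+ n)].

Definition primary_to m q : Prop :=
  [/\ proper_idealr q,
      forall x y, q (x * y) -> q x \/ radical q y
    & radical q = m].

End Rings.

Section Filtrations.
Context {R : comNzRingType} {V : lmodType R}.
Implicit Types (q : set R) (F : nat -> set V).

Definition filtration q F : Prop :=
  [/\ F 0%N = setT,
      forall n, submodule (F n),
      forall n, F n.+1 `<=` F n
    & forall n, ideal_mul q (F n) `<=` F n.+1].

Definition good_filtration q F : Prop :=
  filtration q F /\
  exists n0, forall n, (n0 <= n)%N -> ideal_mul q (F n) = F n.+1.

Definition colon (N : set V) (a : R) : set V := [set x | N (a *: x)].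

(* F / N on V / N, each (F n + N) / N being given by its preimage in V *)
Definition quot_filtration F (N : set V) (n : nat) : set V := add_sub (F n) N.

Definition superficial q F (a : R) : Prop :=
  q a /\ exists c : nat, forall n, (c <= n)%N ->
    colon (F n.+1) a `&` F c = F n.

Definition superficial_seq q F (s : seq R) : Prop :=
  forall i, (i < size s)%N ->
    superficial q
      (quot_filtration F
         (ideal_mul (ideal_span [set` take i s]) [set: V])) s`_i.

Definition hilbert_fun F (n : nat) : nat := length (F n) (F n.+1).

(* h(t) = (1 - t)^d P(t), compared coefficientwise *)
Definition is_hilbert_numerator F (h : {poly int}) : Prop :=
  (forall n, h`_n =
     \sum_(i < n.+1) ((1 - 'X) ^+ kdim V : {poly int})`_i *
                     (hilbert_fun F (n - i))%:Z) /\
  h.[1] != 0.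

Definition hilbert_numerator F : {poly int} :=
  xget 0 [set h | is_hilbert_numerator F h].

(* p^`N(i) is the i-th derivative of p divided by i! *)
Definition hilbert_coef F (i : nat) : int := (hilbert_numerator F)^`N(i).[1].

End Filtrations.

(* The associated graded module of the I-adic filtration of V is the direct sum
   of the I^n V / I^(n+1) V. An element is represented by a finitely supported
   sequence f with f n in I^n V, up to the equivalence gr_eq; elements of the
   associated graded ring of R are the same thing for V = R^o. *)
Section AssociatedGraded.
Context {R : comNzRingType}.
Variables (m I : set R).
Implicit Types (V : lmodType R).

Definition gr_elt V : set (nat -> V) :=
  [set f | (forall n, adic I V n (f n)) /\
           exists n0, forall n, (n0 <= n)%N -> f n = 0].

Arguments gr_elt V : clear implicits.

Definition gr_eq V (f g : nat -> V) : Prop :=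
  forall n, adic I V n.+1 (f n - g n).

Definition gr_act V (p : nat -> R) (f : nat -> V) (n : nat) : V :=
  \sum_(i < n.+1) p i *: f (n - i)%N.

(* the homogeneous maximal ideal m/I + I/I^2 + I^2/I^3 + ... *)
Definition gr_maxideal : set (nat -> R) :=
  [set p | gr_elt R^o p /\ m (p 0%N)].

(* the submodule (p_0, ..., p_(r-1)) gr(V) *)
Definition gr_span V (p : nat -> nat -> R) (r : nat) : set (nat -> V) :=
  [set f | gr_elt V f /\
     exists g : nat -> nat -> V, (forall j, gr_elt V (g j)) /\
       gr_eq f (fun n => \sum_(j < r) gr_act (p j) (g j) n)].

(* p_0, ..., p_(r-1) is a gr(V)-regular sequence in the maximal ideal *)
Definition gr_regular V (p : nat -> nat -> R) (r : nat) : Prop :=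
  [/\ forall i, (i < r)%N -> gr_maxideal (p i),
      forall i, (i < r)%N -> forall f, gr_elt V f ->
        gr_span p i (gr_act (p i) f) -> gr_span p i f
    & ~ (gr_elt V `<=` gr_span p r)].

Definition gr_depth V : nat :=
  supremum 0%N [set r | exists p, gr_regular V p r].

End AssociatedGraded.

Arguments gr_elt {R} I V.
Arguments gr_depth {R} m I V.

(* Main.v *)
Require Import Defs.
From mathcomp Require Import all_boot all_order all_algebra.
From mathcomp Require Import zify ring.
Require Import Defs.

Set Implicit Arguments.
Unset Strict Implicit.
Unset Printing Implicit Defensive.

Import Order.TTheory GRing.Theory Num.Theory.

Local Open Scope classical_set_scope.
Local Open Scope ring_scope.

(** The proof compares the two filtrations piece by piece, with J generated by
    the superficial sequence a_1, ..., a_d and F, N the two filtrations.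

    The sequence being superficial, each a_i avoids the minimal primes of the
    support other than m (superficial_prime); after d steps only m is left
    (support_reduction), so M / J M has finite length. With the Artin-Rees lemma
    this gives F (n + 1) = J F n for large n (reduction). Hence both Hilbert series
    are rational with denominator (1 - T)^d (hilbert_serre), with numerators h_F
    and h_N.

    The chain F (n + 1), J F n, J^2 F (n - 1), ..., J^(n + 1) M expresses
    the length of F (n + 1) / J^(n + 1) M as the sum over i of the lengths of the
    graded modules L_i = (J^k F (i + 1) / J^(k + 1) F i)_k in degree k = n - i
    (length_pieces). Each L_i is a module over polynomials in d variables,
    generated in degree 0 by F (i + 1) / J F i, whose length is denoted v_i; it
    vanishes for large i. A filtration of the degree 0 part with simple quotients
    filters L_i by v_i cyclic modules over the residue field, and such a module is
    either free, with Hilbert series 1 / (1 - T)^d, or of strictly smaller growth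
    (cyclic_hilbert). So the Hilbert function of L_i is that of r_i free modules,
    r_i <= v_i, plus a nonnegative function of smaller growth
    (generated_hilbert).

    Summing over i, with rho = sum_i r_i T^i,
      h_N - h_F = (1 - T) rho + (1 - T)^2 w,
    where w is the numerator, over (1 - T)^(d - 1), of the sum of the remainders,
    whence w(1) >= 0 (small_series_numerator). Comparing second coefficients at 1,
      e_2(F) - e_2(N) = rho'(1) - w(1) <= sum_i i r_i <= sum_i i v_i.

    Graded modules are never formed as types. A graded module is a pair of
    families B k, A k of submodules of one fixed module, with B k inside A k, on
    which the variables act by multiplication by elements of R. *)

(** * Submodules *)

Section SubmoduleLattice.
Context {R : comNzRingType} {V : lmodType R}.
Implicit Types (A B C N X Y : set V) (a b : R) (x y : V) (s t : seq R).

Lemma submoduleP N :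
  submodule N <-> N 0 /\ forall a x y, N x -> N y -> N (a *: x + y).
Proof.
split=> -[N0 NL]; split.
- exact: (set_mem N0).
- by move=> a x y Nx Ny; apply: set_mem; apply: NL; exact: mem_set.
- exact: mem_set.
- by move=> a x y /set_mem Nx /set_mem Ny; apply: mem_set; exact: NL.
Qed.

Lemma sub_0 N : submodule N -> N 0.
Proof. by case/submoduleP. Qed.

Lemma sub_add N x y : submodule N -> N x -> N y -> N (x + y).
Proof. by case/submoduleP=> _ NL Nx Ny; rewrite -[x]scale1r; exact: NL. Qed.

Lemma sub_scale N a x : submodule N -> N x -> N (a *: x).
Proof. by case/submoduleP=> N0 NL Nx; rewrite -[_ *: _]addr0; exact: NL. Qed.

Lemma sub_opp N x : submodule N -> N x -> N (- x).
Proof. by move=> sN Nx; rewrite -scaleN1r; exact: sub_scale. Qed.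

Lemma sub_sub N x y : submodule N -> N x -> N y -> N (x - y).
Proof. by move=> sN Nx Ny; apply: sub_add => //; exact: sub_opp. Qed.

Lemma sub_addlK N x y : submodule N -> N x -> N (x + y) -> N y.
Proof. by move=> sN Nx /(sub_sub sN)/(_ Nx); rewrite addrC addrA addNr add0r. Qed.

Lemma submodule0 : submodule [set 0 : V].
Proof. by apply/submoduleP; split=> // a x y -> ->; rewrite scaler0 addr0. Qed.

Lemma submoduleT : submodule [set: V].
Proof. by apply/submoduleP. Qed.

Lemma submoduleI A B : submodule A -> submodule B -> submodule (A `&` B).
Proof.
move=> /submoduleP[A0 AL] /submoduleP[B0 BL]; apply/submoduleP; split=> //.
by move=> a x y [Ax Bx] [Ay By]; split; [exact: AL|exact: BL].
Qed.

Lemma submodule_add A B : submodule A -> submodule B -> submodule (add_sub A B).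
Proof.
move=> /submoduleP[A0 AL] /submoduleP[B0 BL]; apply/submoduleP; split.
  by exists 0 => //; exists 0 => //; rewrite addr0.
move=> a _ _ [x Ax [y By <-]] [x' Ax' [y' By' <-]].
exists (a *: x + x'); first exact: AL.
by exists (a *: y + y'); [exact: BL|rewrite scalerDr addrACA].
Qed.

Lemma subset_addl A B : submodule B -> A `<=` add_sub A B.
Proof. by move=> sB x Ax; exists x => //; exists 0; [exact: sub_0|rewrite addr0]. Qed.

Lemma subset_addr A B : submodule A -> B `<=` add_sub A B.
Proof. by move=> sA x Bx; exists 0; [exact: sub_0|exists x => //; rewrite add0r]. Qed.

Lemma add_sub_min A B N : submodule N -> A `<=` N -> B `<=` N -> add_sub A B `<=` N.
Proof. by move=> sN AN BN _ [x /AN Nx [y /BN Ny <-]]; exact: sub_add. Qed.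

Lemma add_subS A B A' B' : A `<=` A' -> B `<=` B' -> add_sub A B `<=` add_sub A' B'.
Proof. by move=> AA BB _ [x /AA Ax [y /BB By <-]]; exists x => //; exists y. Qed.

Lemma span_submodule (S : set V) : submodule (span S).
Proof.
apply/submoduleP; split; first by move=> N [/sub_0 N0 _].
move=> a x y Sx Sy N [sN SN]; apply: sub_add => //.
  by apply: sub_scale => //; apply: Sx.
exact: Sy.
Qed.

Lemma span_sub (S : set V) : S `<=` span S.
Proof. by move=> x Sx N [_]; apply. Qed.

Lemma span_min (S : set V) N : submodule N -> S `<=` N -> span S `<=` N.
Proof. by move=> sN SN x; apply. Qed.

Definition scale_set a A : set V := [set a *: x | x in A].

Lemma scale_setP a A x : A x -> scale_set a A (a *: x).
Proof. by move=> Ax; exists x. Qed.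

Lemma submodule_scale a A : submodule A -> submodule (scale_set a A).
Proof.
move=> sA; apply/submoduleP; split; first by exists 0; [exact: sub_0|rewrite scaler0].
move=> b _ _ [x Ax <-] [y Ay <-]; exists (b *: x + y).
  by apply: sub_add => //; exact: sub_scale.
by rewrite scalerDr !scalerA mulrC.
Qed.

Lemma submodule_colon a A : submodule A -> submodule (colon A a).
Proof.
move=> sA; apply/submoduleP; split; first by rewrite /colon /= scaler0; exact: sub_0.
move=> b x y Ax Ay; rewrite /colon /= scalerDr scalerA mulrC -scalerA.
by apply: sub_add => //; exact: sub_scale.
Qed.

Lemma scale_setS a A B : A `<=` B -> scale_set a A `<=` scale_set a B.
Proof. by move=> AB _ [x Ax <-]; exists x => //; exact: AB. Qed.

Definition line x : set V := [set r *: x | r in setT].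

Lemma submodule_line x : submodule (line x).
Proof.
apply/submoduleP; split; first by exists 0; rewrite ?scale0r.
by move=> a _ _ [r _ <-] [r' _ <-]; exists (a * r + r') => //; rewrite scalerDl scalerA.
Qed.

Lemma line_refl x : line x x.
Proof. by exists 1 => //; rewrite scale1r. Qed.

Lemma line_sub x N : submodule N -> N x -> line x `<=` N.
Proof. by move=> sN Nx _ [r _ <-]; exact: sub_scale. Qed.

(** The product of the ideal generated by s with A. Its elements are explicit
    sums with one term for each entry of s, so that inductions on the number of
    generators can split off one of them. *)
Definition seq_mul s A : set V :=
  foldr (fun a X => add_sub (scale_set a A) X) [set 0] s.

Lemma submodule_seq_mul s A : submodule A -> submodule (seq_mul s A).
Proof.
move=> sA; elim: s => [|a s IH] /=; first exact: submodule0.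
by apply: submodule_add => //; exact: submodule_scale.
Qed.

Lemma seq_mul_mem s A a x : submodule A -> a \in s -> A x -> seq_mul s A (a *: x).
Proof.
move=> sA; elim: s => [|b s IH] //=; rewrite inE => /predU1P[->|/IH as_] Ax.
  by apply: subset_addl; [exact: submodule_seq_mul|exists x].
by apply: subset_addr; [exact: submodule_scale|exact: as_].
Qed.

Lemma seq_mul_min s A N : submodule N ->
  (forall a x, a \in s -> A x -> N (a *: x)) -> seq_mul s A `<=` N.
Proof.
move=> sN; elim: s => [|a s IH] /= AN; first by move=> _ ->; exact: sub_0.
apply: add_sub_min => //; first by move=> _ [x Ax <-]; apply: AN; rewrite ?inE ?eqxx.
by apply: IH => b x bs; apply: AN; rewrite inE bs orbT.
Qed.

Lemma seq_mul_sub s A : submodule A -> seq_mul s A `<=` A.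
Proof. by move=> sA; apply: seq_mul_min => // a x _; exact: sub_scale. Qed.

Lemma seq_mulS s A B : submodule B -> A `<=` B -> seq_mul s A `<=` seq_mul s B.
Proof.
move=> sB AB; apply: seq_mul_min; first exact: submodule_seq_mul.
by move=> a x as_ /AB; exact: seq_mul_mem.
Qed.

Lemma seq_mul_scale s a A : submodule A ->
  seq_mul s (scale_set a A) = scale_set a (seq_mul s A).
Proof.
move=> sA; apply/seteqP; split.
  apply: seq_mul_min; first exact/submodule_scale/submodule_seq_mul.
  move=> b _ bs [x Ax <-]; exists (b *: x); first exact: seq_mul_mem.
  by rewrite !scalerA mulrC.
move=> _ [x + <-]; elim: s x => [|b s IH] x /=; first by move=> ->; rewrite scaler0.
move=> [_ [y Ay <-] [z Az <-]]; exists (b *: (a *: y)).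
  by exists (a *: y) => //; exists y.
by exists (a *: z); [exact: IH|rewrite scalerDr !scalerA mulrC].
Qed.

Lemma seq_mul_add s A B : submodule A -> submodule B ->
  seq_mul s (add_sub A B) `<=` add_sub (seq_mul s A) (seq_mul s B).
Proof.
move=> sA sB; apply: seq_mul_min; first by apply: submodule_add; exact: submodule_seq_mul.
move=> a _ as_ [x Ax [y By <-]]; rewrite scalerDr.
by exists (a *: x); [|exists (a *: y)]; rewrite //; exact: seq_mul_mem.
Qed.

Lemma ideal_mul_span s A : submodule A ->
  ideal_mul (ideal_span [set` s]) A = seq_mul s A.
Proof.
move=> sA; apply/seteqP; split.
  apply: span_min; first exact: submodule_seq_mul.
  move=> _ [a sa [x Ax <-]]; move: a sa x Ax.
  suff: ideal_span [set` s] `<=` [set a | forall x, A x -> seq_mul s A (a *: x)] by [].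
  have sS := submodule_seq_mul s sA.
  apply: smallest_sub; last by move=> a /= sa x; exact: seq_mul_mem.
  split; first by apply: mem_set => x _; rewrite scale0r; exact: sub_0.
  move=> c u v /set_mem Nu /set_mem Nv; apply: mem_set => x Ax.
  by rewrite scalerDl -scalerA; apply: sub_add; [|apply: sub_scale; [|exact: Nu]|exact: Nv].
apply: seq_mul_min; first exact: span_submodule.
move=> a x sa Ax; apply: span_sub; exists a; last by exists x.
by move=> N [_]; apply.
Qed.

End SubmoduleLattice.
(** * Length *)

Section Length.
Context {R : comNzRingType} {V : lmodType R}.
Implicit Types (A B C N X Y : set V) (a : R) (x y : V).

Definition between B A : set (set V) :=
  [set N | [/\ submodule N, B `<=` N & N `<=` A]].

Definition finite_length A B : Prop :=
  exists n, ubound (chain_lengths (between B A)) n.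

Lemma chain_lengths0 A B : submodule B -> B `<=` A ->
  chain_lengths (between B A) 0%N.
Proof. by move=> sB BA; exists (fun=> B); split=> // i _; split. Qed.

Lemma nat_supremumP (S : set nat) n k : ubound S n -> S k ->
  S (supremum 0%N S) /\ ubound S (supremum 0%N S).
Proof.
move=> Sn Sk; have [s0 s0P] := nat_supremums_neq0 (ex_intro _ n Sn).
rewrite /supremum; case: ifPn => [/eqP S0|_]; first by rewrite S0 in Sk.
case: xgetP => [s _ [us ls]|/(_ s0) //]; split=> //; apply: contrapT => nSs.
case: s us ls nSs => [|s] us ls nSs; first by apply: nSs; case: k Sk (us _ Sk).
suff: ubound S s by move=> /ls; rewrite /Order.le /= ltnn.
move=> j Sj; have := us j Sj; rewrite /Order.le /= leq_eqVlt => /predU1P[js|//].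
by rewrite js in Sj.
Qed.

Lemma length_chain A B : finite_length A B -> submodule B -> B `<=` A ->
  chain_lengths (between B A) (length A B).
Proof.
move=> [n nP] sB BA.
by have [] := nat_supremumP nP (chain_lengths0 sB BA).
Qed.

Lemma chain_length_le A B k : finite_length A B ->
  chain_lengths (between B A) k -> (k <= length A B)%N.
Proof. by move=> [n nP] kP; have [_] := nat_supremumP nP kP; apply. Qed.

Lemma chain_length_rank A B (rk : set V -> nat) :
  (forall X Y, between B A X -> between B A Y -> X `<` Y -> (rk X < rk Y)%N) ->
  forall k, chain_lengths (between B A) k ->
    exists X Y, [/\ between B A X, between B A Y & (rk X + k <= rk Y)%N].
Proof.
move=> rkP k [P [PC Plt]]; exists (P 0%N), (P k); split; [exact: PC|exact: PC|].
suff: forall i, (i <= k)%N -> (rk (P 0%N) + i <= rk (P i))%N by apply.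
elim=> [|i IH] ik; first by rewrite addn0.
rewrite addnS; apply: leq_ltn_trans (IH (ltnW ik)) _.
by apply: rkP; [apply: PC; exact: ltnW|exact: PC|exact: Plt].
Qed.

(** Every upper bound on a length is obtained by exhibiting a strictly increasing
    rank on the submodules between B and A: it grows along each step of a chain. *)
Lemma finite_length_rank A B (rk : set V -> nat) n :
  submodule B -> B `<=` A ->
  (forall X Y, between B A X -> between B A Y -> X `<` Y -> (rk X < rk Y)%N) ->
  (forall X, between B A X -> (rk X <= n)%N) ->
  finite_length A B /\ (length A B <= n)%N.
Proof.
move=> sB BA rkP rkn.
have ub k : chain_lengths (between B A) k -> (k <= n)%N.
  move=> /(chain_length_rank rkP)[X [Y [_ /rkn Yn XY]]].
  exact: leq_trans (leq_trans (leq_addl _ _) XY) Yn.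
have fl : finite_length A B by exists n => k /ub.
by split=> //; apply: ub; exact: length_chain.
Qed.

Lemma finite_length_sub A B A' B' : B' `<=` B -> A `<=` A' ->
  finite_length A' B' -> finite_length A B.
Proof.
move=> BB AA [n nP]; exists n => k [P [PC Plt]]; apply: nP; exists P; split=> //.
by move=> i /PC[sP BP PA]; split=> //; [apply: subset_trans BP|apply: subset_trans AA].
Qed.

Lemma chain_lengths_cat A B C i j : submodule B -> C `<=` B -> B `<=` A ->
  chain_lengths (between C B) i -> chain_lengths (between B A) j ->
  chain_lengths (between C A) (i + j).
Proof.
move=> sB CB BA [P [PC Plt]] [Q [QC Qlt]].
exists (fun k => if (k <= i)%N then P k else Q (k - i)%N); split=> k kij.
  case: leqP => ki; first by have [? ? ?] := PC _ ki; split=> //; apply: subset_trans BA.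
  have [|? ? ?] := QC (k - i)%N; first by rewrite leq_subLR.
  by split=> //; apply: subset_trans CB _.
case: (ltngtP k i) => [ki|ki|ki].
- exact: Plt.
- rewrite subSn; last exact: ltnW.
  by apply: Qlt; lia.
- rewrite ki subSnn; have [|Q01 Q10] := Qlt 0%N _; first by lia.
  have [_ _ PB] := PC i (leqnn _); have [|_ BQ _] := QC 0%N; first by [].
  split; first by move=> x /PB /BQ /Q01.
  by move=> QP; apply: Q10 => x /QP /PB /BQ.
Qed.

Lemma length_ltn_sub A X Y C : finite_length A C -> submodule X -> submodule Y ->
  C `<=` X -> X `<` Y -> Y `<=` A -> submodule C -> (length X C < length Y C)%N.
Proof.
move=> fl sX sY CX XY YA sC.
have flY : finite_length Y C by apply: finite_length_sub fl.
have flX : finite_length X C by apply: finite_length_sub flY => //; case: XY.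
apply: chain_length_le => //; rewrite -addn1.
apply: (chain_lengths_cat (B := X)) => //; first by case: XY.
  exact: length_chain.
exists (fun i => if i is 0%N then X else Y); split; last by case.
by case=> [|i] _; split=> //; case: XY.
Qed.

Lemma length_le_sub A B A' B' : finite_length A' B' -> submodule B -> B `<=` A ->
  B' `<=` B -> A `<=` A' -> (length A B <= length A' B')%N.
Proof.
move=> fl sB BA BB AA; apply: chain_length_le => //.
have [P [PC Plt]] := length_chain (finite_length_sub BB AA fl) sB BA.
exists P; split=> // i /PC[sP BP PA]; split=> //.
  exact: subset_trans BP.
exact: subset_trans AA.
Qed.

(** The modular law in the form used for the additivity of length: an inclusion
    that is strict cannot become an equality both on intersecting with B and on
    adding B. *)
Lemma modular_strict B X Y : submodule B -> submodule X -> submodule Y -> X `<=` Y ->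
  Y `&` B `<=` X `&` B -> add_sub Y B `<=` add_sub X B -> Y `<=` X.
Proof.
move=> sB sX sY XY YBX YX y Yy.
have [x Xx [b Bb xby]] := YX y (subset_addl sB Yy).
have [] : (X `&` B) b by apply: YBX; split=> //; apply: (sub_addlK sY (XY _ Xx)); rewrite xby.
by move=> Xb _; rewrite -xby; exact: sub_add.
Qed.

(** A chain from C to A gives, by intersection with B and addition of B, chains
    from C to B and from B to A which together keep all its strict steps. *)
Lemma lengthD A B C : submodule A -> submodule B -> submodule C ->
  C `<=` B -> B `<=` A -> finite_length A B -> finite_length B C ->
  finite_length A C /\ length A C = (length A B + length B C)%N.
Proof.
move=> sA sB sC CB BA flAB flBC.
have CA := subset_trans CB BA.
pose rk X := (length (add_sub X B) B + length (X `&` B) C)%N.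
have meet X : between C A X -> submodule (X `&` B) /\ C `<=` X `&` B.
  by case=> sX CX XA; split; [exact: submoduleI|move=> x Cx; split; [exact: CX|exact: CB]].
have join X : between C A X -> submodule (add_sub X B) /\ B `<=` add_sub X B.
  by case=> sX CX XA; split; [exact: submodule_add|exact: subset_addr].
have joinA X : between C A X -> add_sub X B `<=` A.
  by case=> sX CX XA; exact: add_sub_min.
have [||fl le] := @finite_length_rank A C rk (length A B + length B C) sC CA.
- move=> X Y XC YC [XY nYX]; rewrite /rk.
  have [[sX CX XA] [sY CY YA]] := (XC, YC).
  have [[sXB CXB] [sYB CYB]] := (meet _ XC, meet _ YC).
  have [[sXB' BX] [sYB' BY]] := (join _ XC, join _ YC).
  have XYB : X `&` B `<=` Y `&` B by move=> x [/XY].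
  have XYB' : add_sub X B `<=` add_sub Y B by exact: add_subS.
  have [YB|YB] := pselect (Y `&` B `<=` X `&` B).
    have nYB : ~ (add_sub Y B `<=` add_sub X B).
      by move=> H; apply: nYX; exact: (modular_strict sB sX sY XY).
    rewrite -addSn; apply: leq_add.
      by apply: (length_ltn_sub flAB) => //; exact: joinA.
    apply: length_le_sub => //; apply: finite_length_sub flBC => //; exact: subIsetr.
  rewrite -addnS; apply: leq_add; last first.
    by apply: (length_ltn_sub flBC) => //; exact: subIsetr.
  apply: length_le_sub => //; apply: finite_length_sub flAB => //; exact: joinA.
- move=> X XC; have [[sXB CXB] [sXB' BX]] := (meet _ XC, join _ XC).
  by apply: leq_add; apply: length_le_sub => //; exact: joinA.
split=> //; apply/eqP; rewrite eqn_leq le addnC /=; apply: chain_length_le => //.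
by apply: (chain_lengths_cat (B := B)) => //; exact: length_chain.
Qed.

Lemma lengthxx A : submodule A -> finite_length A A /\ length A A = 0%N.
Proof.
move=> sA; have [||fl] := @finite_length_rank A A (fun=> 0%N) 0 sA (@subset_refl _ A).
- by move=> X Y [_ AX _] [_ _ YA] [_ nYX]; case: nYX; exact: subset_trans AX.
- by [].
- by rewrite leqn0 => /eqP.
Qed.

Lemma length_eq0 A B : finite_length A B -> submodule A -> submodule B ->
  B `<=` A -> length A B = 0%N -> A `<=` B.
Proof.
move=> fl sA sB BA l0; apply: contrapT => nAB.
have := @length_ltn_sub A B A B fl sB sA (@subset_refl _ B) (conj BA nAB).
by rewrite l0; move=> /(_ (@subset_refl _ A) sB).
Qed.

(** Multiplication by a matches the submodules between A and the preimage of B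
    with those between a A + B and B. *)
Lemma length_scale a A B : submodule A -> submodule B ->
  finite_length (add_sub (scale_set a A) B) B ->
  finite_length A (A `&` colon B a) /\
  length (add_sub (scale_set a A) B) B = length A (A `&` colon B a).
Proof.
move=> sA sB fl.
have saA := submodule_scale a sA; have scB := submodule_colon a sB.
have sK := submoduleI sA scB; set K := A `&` colon B a in sK *.
have KA : K `<=` A by exact: subIsetl.
pose up X := add_sub (scale_set a X) B.
have sup X : submodule X -> submodule (up X).
  by move=> sX; apply: submodule_add => //; exact: submodule_scale.
have Bup X : submodule X -> B `<=` up X.
  by move=> sX; apply: subset_addr; exact: submodule_scale.
have upS X Y : X `<=` Y -> up X `<=` up Y.
  by move=> XY; apply: add_subS => //; exact: scale_setS.
have upK X : between K A X -> forall y, A y -> up X (a *: y) -> X y.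
  move=> [sX KX XA] y Ay [_ [x Xx <-] [b Bb axb]].
  have : K (y - x).
    by split; [apply: sub_sub => //; exact: XA|rewrite /colon /= scalerBr -axb addrC addKr].
  by move=> /KX Xyx; rewrite -(subrK x y); exact: sub_add.
have [||flK le1] := @finite_length_rank A K (fun X => length (up X) B)
    (length (up A) B) sK KA.
- move=> X Y XK YK [XY nYX]; have [[sX KX XA] [sY KY YA]] := (XK, YK).
  apply: (length_ltn_sub fl); [exact: sup|exact: sup|exact: Bup| |exact: upS|by []].
  split; first exact: upS.
  move=> YX; apply: nYX => y Yy; apply: (upK X XK); first exact: YA.
  by apply: YX; apply: subset_addl => //; exact: scale_setP.
- by move=> X [sX KX XA]; apply: length_le_sub => //; [exact: Bup|exact: upS].
split=> //; apply/eqP; rewrite eqn_leq le1 andbT.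
have [||//] := @finite_length_rank (up A) B (fun Y => length (A `&` colon Y a) K)
  (length A K) sB (Bup _ sA).
- move=> X Y [sX BX XA] [sY BY YA] [XY nYX].
  have KI Z : B `<=` Z -> K `<=` A `&` colon Z a by move=> BZ x [Ax /BZ].
  apply: (length_ltn_sub flK); rewrite ?/K //.
  + exact: submoduleI (submodule_colon a sX).
  + exact: submoduleI (submodule_colon a sY).
  + exact: KI.
  + split; first by move=> x [Ax /XY].
    move=> YX; apply: nYX => y Yy; have [_ [x Ax <-] [b Bb axb]] := YA y Yy.
    rewrite -axb; apply: sub_add => //; last exact: BX.
    suff [] : (A `&` colon X a) x by [].
    apply: YX; split=> //; rewrite /colon /= -[_ *: _](addrK b) axb.
    by apply: sub_sub => //; exact: BY.
- move=> Y [sY BY YA]; apply: length_le_sub => //.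
  by move=> x [Ax Bx]; split=> //; exact: BY.
Qed.

Lemma length_scale_le a A B A' B' : submodule A -> submodule B -> submodule B' ->
  finite_length (add_sub (scale_set a A) B') B' -> finite_length A B ->
  B `<=` A -> scale_set a B `<=` B' -> A' `<=` add_sub (scale_set a A) B' ->
  submodule A' -> B' `<=` A' -> (length A' B' <= length A B)%N.
Proof.
move=> sA sB sB' fl' fl BA aB AA' sA' BA'.
have [flK lK] := length_scale sA sB' fl'.
apply: leq_trans (length_le_sub fl' sB' BA' (@subset_refl _ _) AA') _.
rewrite lK; apply: length_le_sub => //.
- exact: submoduleI (submodule_colon a sB').
- by move=> x Bx; split; [exact: BA|apply: aB; exact: scale_setP].
Qed.

Lemma length_telescope (U : nat -> set V) n : (forall i, submodule (U i)) ->
  (forall i, (i < n)%N -> U i.+1 `<=` U i) ->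
  (forall i, (i < n)%N -> finite_length (U i) (U i.+1)) ->
  finite_length (U 0%N) (U n) /\
  length (U 0%N) (U n) = (\sum_(i < n) length (U i) (U i.+1))%N.
Proof.
move=> sU; elim: n => [|n IH] dU flU.
  by rewrite big_ord0; exact: lengthxx.
have [||fl lU] := IH.
- by move=> i ni; exact/dU/ltnW.
- by move=> i ni; exact/flU/ltnW.
have U0 i : (i <= n)%N -> U i `<=` U 0%N.
  elim: i => [_|i IHi ni]; first exact: subset_refl.
  by apply: subset_trans (IHi (ltnW ni)); exact/dU/ltnW.
rewrite big_ord_recr /= -lU.
by apply: lengthD => //; [exact: dU|exact: U0|exact: flU].
Qed.

(** A module generated by one vector whose annihilator contains all non-units has
    no submodule other than zero and itself. *)
Lemma length_line A B x : submodule A -> submodule B -> B `<=` A ->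
  A `<=` add_sub (line x) B ->
  (forall r, B (r *: x) \/ exists r', r' * r = 1) ->
  finite_length A B /\ (length A B <= 1)%N.
Proof.
move=> sA sB BA Ax rP.
have top X : between B A X -> X `<=` B \/ A `<=` X.
  move=> [sX BX XA].
  have [XB|/existsNP[y /not_implyP[Xy nBy]]] := pselect (X `<=` B); [by left|right].
  have [_ [r _ <-] [b Bb rxb]] := Ax _ (XA _ Xy).
  have [Brx|[r' r'r]] := rP r; first by case: nBy; rewrite -rxb; exact: sub_add.
  have Xx : X x.
    rewrite -[x]scale1r -r'r -scalerA -[r *: x](addrK b) rxb.
    by apply: sub_scale => //; apply: sub_sub => //; exact: BX.
  by apply: subset_trans Ax _; apply: add_sub_min => //; exact: line_sub.
have [AB|nAB] := pselect (A `<=` B).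
  by rewrite (_ : A = B); [have [fl ->] := lengthxx sB|apply/seteqP].
apply: (@finite_length_rank A B (fun X => `[< A `<=` X >] : nat)) => //.
- move=> X Y XC YC [XY nYX].
  have [AX|nAX] := pselect (A `<=` X).
    by case: nYX; apply: subset_trans AX; case: YC.
  rewrite (asboolF nAX) lt0b; apply: asboolT.
  have [XB|//] := top X XC; have [YB|//] := top Y YC.
  by case: nYX; apply: subset_trans YB _; case: XC.
- by move=> X _; exact: leq_b1.
Qed.

End Length.
(** * Chain conditions *)

Section ChainConditions.
Context {R : comNzRingType}.

Definition acc_in {V : lmodType R} (A : set V) : Prop :=
  forall P : nat -> set V, (forall i, submodule (P i)) ->
    (forall i, P i `<=` P i.+1) -> (forall i, P i `<=` A) ->
    exists n, forall i, (n <= i)%N -> P i `<=` P n.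

Definition acc (V : lmodType R) : Prop := acc_in [set: V].

Lemma homo_chain {T} (P : nat -> set T) : (forall i, P i `<=` P i.+1) ->
  forall i j, (i <= j)%N -> P i `<=` P j.
Proof.
move=> inc i j /subnK <-; elim: (j - i)%N => [|k IH]; first exact: subset_refl.
by rewrite addSn; apply: subset_trans IH _; exact: inc.
Qed.

Lemma union_chain_submodule {V : lmodType R} (P : nat -> set V) :
  (forall i, submodule (P i)) -> (forall i, P i `<=` P i.+1) ->
  submodule [set x | exists i, P i x].
Proof.
move=> sP inc; apply/submoduleP; split; first by exists 0%N; exact: sub_0.
move=> a x y [i Px] [j Py]; exists (maxn i j); apply: sub_add => //.
  by apply: sub_scale => //; apply: (homo_chain inc) Px; exact: leq_maxl.
by apply: (homo_chain inc) Py; exact: leq_maxr.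
Qed.

Lemma noetherian_acc : noetherian_ring R -> acc R^o.
Proof.
move=> noeth P sP inc _; have sU := union_chain_submodule sP inc.
have [s sE] := noeth _ sU.
have [n sn] : exists n, [set` s] `<=` P n.
  have : [set` s] `<=` [set x | exists i, P i x] by rewrite -sE; exact: (@span_sub R R^o).
  elim: s {sE} => [|a s IH] sP'; first by exists 0%N.
  have [|n nP] := IH; first by move=> x /= xs; apply: sP'; rewrite /= inE xs orbT.
  have [k kP] : exists i, P i a by apply: (sP' a); rewrite /= inE eqxx.
  exists (maxn n k) => x /=; rewrite inE => /predU1P[->|/nP].
    by apply: (homo_chain inc) kP; exact: leq_maxr.
  by apply: (homo_chain inc); exact: leq_maxl.
exists n => i _ x Px; suff UP : [set x | exists i, P i x] `<=` P n by exact: (UP x (ex_intro _ i Px)).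
by rewrite -sE; exact: (@span_min R R^o).
Qed.

(** A submodule P of R x + A is recovered from its intersection with A and the
    ideal of the r such that r x lies in P + A. *)
Lemma acc_in_line (V : lmodType R) (A : set V) (x : V) :
  acc R^o -> submodule A -> acc_in A -> acc_in (add_sub (line x) A).
Proof.
move=> accR sA accA P sP inc PA.
have [|||n1 n1P] := accA (fun i => P i `&` A).
- by move=> i; exact: submoduleI.
- by move=> i y [/inc].
- by move=> i y [].
have sPA i : submodule (add_sub (P i) A) by exact: submodule_add.
have [|||n2 n2P] := accR (fun i => [set r : R^o | add_sub (P i) A (r *: x)]).
- move=> i; apply/submoduleP; split; first by rewrite /= scale0r; apply: sub_0 (sPA i).
  move=> a u v /= Pu Pv; rewrite scalerDl.
  have -> : (a *: u) *: x = a *: ((u : R) *: x) by rewrite scalerA.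
  exact: sub_add (sPA i) (sub_scale a (sPA i) Pu) Pv.
- by move=> i r /=; apply: add_subS => //; exact: inc.
- by [].
exists (maxn n1 n2) => i; rewrite geq_max => /andP[n1i n2i] y Py.
have [_ [r _ <-] [z Az rxz]] := PA _ _ Py.
have [p Pp [z' Az' pz]] : add_sub (P n2) A (r *: x).
  by apply: (n2P i n2i); exists y => //; exists (- z); rewrite -?rxz ?addrK //; exact: sub_opp.
have Pip : P i p by exact: (homo_chain inc n2i).
have [Pyp _] : (P n1 `&` A) (y - p).
  apply: (n1P i n1i); split; first exact: sub_sub.
  by rewrite -rxz -pz addrAC [p + z']addrC addrK; exact: sub_add.
rewrite -(subrK p y); apply: sub_add => //.
  by apply: (homo_chain inc) Pyp; exact: leq_maxl.
by apply: (homo_chain inc) Pp; exact: leq_maxr.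
Qed.

Lemma fg_acc (V : lmodType R) : noetherian_ring R -> fg_module V -> acc V.
Proof.
move=> /noetherian_acc accR [s sV].
pose S (t : seq V) := foldr (fun x A => add_sub (line x) A) [set 0] t.
have sS t : submodule (S t).
  elim: t => [|x t IH] /=; first exact: submodule0.
  by apply: submodule_add => //; exact: submodule_line.
have accS t : acc_in (S t).
  elim: t => [|x t IH] /=; last exact: acc_in_line.
  move=> P sP _ P0; exists 0%N => i _ x /P0 ->; exact: sub_0.
suff SV : [set: V] `<=` S s by move=> P sP inc _; apply: accS => // i x _; exact: SV.
rewrite -sV; apply: span_min => //= x; elim: s {sV} => [//|y t IH] /=.
rewrite inE => /predU1P[->|/IH Sx]; last by apply: subset_addr; first exact: submodule_line.
by apply: subset_addl => //; exact: line_refl.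
Qed.

Lemma acc_maximal (V : lmodType R) (C : set (set V)) X0 : acc V ->
  C `<=` @submodule R V -> C X0 ->
  exists X, C X /\ forall Y, C Y -> X `<=` Y -> Y `<=` X.
Proof.
move=> accV Csub CX0; apply: contrapT => nmax.
have next X : exists Y, C X -> [/\ C Y, X `<=` Y & ~ (Y `<=` X)].
  have [CX|nCX] := pselect (C X); last by exists X.
  apply: contrapT => nY; apply: nmax; exists X; split=> // Y CY XY.
  by apply: contrapT => nYX; apply: nY; exists Y.
have [f fP] := boolp.choice next.
have CP i : C (iter i f X0) by elim: i => [//|i IH]; have [] := fP _ IH.
have [|||n nP] := accV (fun i => iter i f X0).
- by move=> i; exact: Csub.
- by move=> i; have [] := fP _ (CP i).
- by [].
by have [_ _] := fP _ (CP n); apply; exact: (nP n.+1 (leqnSn n)).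
Qed.

(** * Local rings and prime ideals *)

Local Notation ideal I := (@submodule R R^o I).

Lemma proper_idealrP (I : set R) :
  proper_idealr I <-> ideal I /\ ~ I 1.
Proof.
split=> [[I0 /negP I1 IL]|[/submoduleP[I0 IL] I1]].
  split; last by move=> ?; apply: I1; exact: mem_set.
  apply/submoduleP; split; first exact: (set_mem I0).
  by move=> a x y Ix Iy; apply: set_mem; apply: IL; exact: mem_set.
split; first exact: mem_set.
  by apply/negP => /set_mem.
by move=> a x y /set_mem Ix /set_mem Iy; apply: mem_set; exact: IL.
Qed.

Lemma idealD (I : set R) x y : ideal I -> I x -> I y -> I (x + y).
Proof. exact: (@sub_add _ R^o). Qed.

Lemma idealM (I : set R) a x : ideal I -> I x -> I (a * x).
Proof. exact: (@sub_scale _ R^o). Qed.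

Lemma prime_idealrP (P : set R) : prime_idealr P ->
  [/\ ideal P, ~ P 1 & forall u v, P (u * v) -> P u \/ P v].
Proof.
move=> [/proper_idealrP[sP P1] Pp]; split=> // u v Puv.
by have /orP[/set_mem|/set_mem] := Pp u v (mem_set Puv); [left|right].
Qed.

Lemma prime_exp (P : set R) x n : prime_idealr P -> P (x ^+ n) -> P x.
Proof.
move=> /prime_idealrP[_ P1 Pp]; elim: n => [|n IH]; first by rewrite expr0.
by rewrite exprS => /Pp[|/IH].
Qed.

Section Local.
Variable m : set R.
Hypothesis noeth : noetherian_ring R.
Hypothesis R_local : local_ring m.

Lemma local_proper : ideal m /\ ~ m 1.
Proof. by apply/proper_idealrP; case: R_local => -[]. Qed.

Lemma proper_sub_local (I : set R) : ideal I -> ~ I 1 -> I `<=` m.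
Proof.
move=> sI I1; have [||K [[sK IK K1] Kmax]] := @acc_maximal R^o
    [set K : set R | [/\ ideal K, I `<=` K & ~ K 1]] I (noetherian_acc noeth).
- by move=> K [].
- by split.
suff <- : K = m by [].
case: R_local => _; apply; split; first exact/proper_idealrP.
move=> L /proper_idealrP[sL L1] KL; apply/seteqP; split=> //.
by apply: Kmax => //; split=> //; exact: subset_trans KL.
Qed.

Lemma local_unit x : ~ m x -> exists y, y * x = 1.
Proof.
move=> mx; apply: contrapT => nu; apply: mx.
apply: (@proper_sub_local (@line R R^o x)); first exact: submodule_line.
  by case=> y _ yx; apply: nu; exists y.
exact: (@line_refl R R^o).
Qed.

(** An ideal maximal among those that contain I and avoid S is prime. *)
Lemma prime_avoiding (I S : set R) : ideal I ->
  S 1 -> (forall x y, S x -> S y -> S (x * y)) -> (forall x, I x -> ~ S x) ->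
  exists Q, [/\ prime_idealr Q, I `<=` Q & forall x, Q x -> ~ S x].
Proof.
move=> sI S1 SM IS.
have [||Q [[sQ IQ QS] Qmax]] := @acc_maximal R^o
    [set K : set R | [/\ ideal K, I `<=` K & forall x, K x -> ~ S x]] I (noetherian_acc noeth).
- by move=> K [].
- by split.
exists Q; split=> //; split.
  by apply/proper_idealrP; split=> // /QS.
move=> u v /set_mem Quv; apply/orP; apply: contrapT => /not_orP[Qu Qv].
have meet w : ~ w \in Q -> exists a q, Q q /\ S (a * w + q).
  move=> Qw; apply: contrapT => nS; apply: Qw; apply: mem_set.
  have sK := @submodule_add R R^o _ _ (@submodule_line R R^o w) sQ.
  apply: (Qmax _ _ (@subset_addr R R^o _ _ (@submodule_line R R^o w))).
    split=> //; first exact: subset_trans IQ (@subset_addr R R^o _ _ (@submodule_line R R^o w)).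
    by move=> _ [_ [a _ <-] [q Qq <-]] Saq; apply: nS; exists a, q.
  by apply: (@subset_addl R R^o) => //; exact: (@line_refl R R^o).
have [a [p [Qp Sp]]] := meet u Qu; have [b [q [Qq Sq]]] := meet v Qv.
apply: QS (SM _ _ Sp Sq).
have -> : (a * u + p) * (b * v + q) = a * b * (u * v) + ((a * u + p) * q + b * v * p) by ring.
by apply: idealD => //; [exact: idealM|apply: idealD => //; exact: idealM].
Qed.

End Local.

End ChainConditions.
(** * Finite length and Nakayama's lemma over a local ring *)

Section LocalModules.
Context {R : comNzRingType}.
Variable m : set R.
Hypothesis noeth : noetherian_ring R.
Hypothesis R_local : local_ring m.
Context {V : lmodType R}.
Hypothesis accV : acc V.
Implicit Types (A B E N X : set V).

(** If E is not contained in N, take X maximal among the submodules that contain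
    N but not E. Some multiple b e with b in t and e in E lies outside X, hence
    generates E modulo X; writing e in terms of b e makes e a vector of X, because
    1 - r b is a unit. *)
Lemma nakayama (t : seq R) E N : {in t, forall a, m a} -> submodule E -> submodule N ->
  E `<=` add_sub (seq_mul t E) N -> E `<=` N.
Proof.
move=> tm sE sN EtE; apply: contrapT => nEN.
have [||X [[sX NX nEX] Xmax]] := @acc_maximal R V
    [set X | [/\ submodule X, N `<=` X & ~ (E `<=` X)]] N accV.
- by move=> X [].
- by split.
apply: nEX; apply: subset_trans EtE _; apply: add_sub_min => //.
apply: seq_mul_min => // b e bt Ee; apply: contrapT => nXbe.
have sXb := submodule_add (submodule_line (b *: e)) sX.
have EXb : E `<=` add_sub (line (b *: e)) X.
  apply: contrapT => nE; apply: nXbe.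
  apply: (Xmax _ _ (subset_addr (submodule_line (b *: e)))).
    by split=> //; apply: subset_trans NX _; apply: subset_addr; exact: submodule_line.
  by apply: subset_addl => //; exact: line_refl.
have [_ [r _ <-] [x Xx rbex]] := EXb e Ee.
have [sm m1] := local_proper R_local.
have [|u u1] := local_unit noeth R_local (x := 1 - r * b).
  by move=> mu; apply: m1; rewrite -(subrK (r * b) 1); apply: idealD => //; apply: idealM => //; exact: tm.
apply: nXbe; apply: sub_scale => //.
rewrite -[e]scale1r -u1 -scalerA; apply: sub_scale => //.
by rewrite scalerBl scale1r -scalerA -[in X in X - _]rbex addrAC subrr add0r.
Qed.

(** Among the vectors of A outside B, one whose annihilator modulo B is maximal
    is killed by m. *)
Lemma exists_socle A B : submodule A -> submodule B ->
  (forall y x, m y -> A x -> exists k, B (y ^+ k *: x)) -> ~ (A `<=` B) ->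
  exists x, [/\ A x, ~ B x & forall y, m y -> B (y *: x)].
Proof.
move=> sA sB nilp /existsNP[x0 /not_implyP[Ax0 nBx0]].
pose ann x : set R := [set r | B (r *: x)].
have [||_ [[x [Ax nBx ->]] annmax]] := @acc_maximal R R^o
    [set K | exists x, [/\ A x, ~ B x & K = ann x]] (ann x0) (noetherian_acc noeth).
- move=> _ [x [Ax nBx ->]]; apply/submoduleP; split.
    by rewrite /ann /= scale0r; exact: sub_0.
  move=> a u v Bu Bv; rewrite /ann /= scalerDl.
  have -> : (a *: u) *: x = a *: ((u : R) *: x) by rewrite scalerA.
  exact: sub_add sB (sub_scale a sB Bu) Bv.
- by exists x0.
exists x; split=> // y my; apply: contrapT => nByx.
have [k Bk] := nilp y x my Ax.
suff : forall i, ~ B (y ^+ i *: x) by move/(_ k).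
elim=> [|i IH]; first by rewrite expr0 scale1r.
rewrite exprSr -scalerA => Bi; apply: IH.
suff : ann (y *: x) `<=` ann x by apply.
apply: annmax; first by exists (y *: x); split=> //; exact: sub_scale.
by move=> r Br; rewrite /ann /= scalerA mulrC -scalerA; exact: sub_scale.
Qed.

Lemma length_line_local A B x : submodule A -> submodule B -> B `<=` A ->
  A `<=` add_sub (line x) B -> (forall y, m y -> B (y *: x)) ->
  finite_length A B /\ (length A B <= 1)%N.
Proof.
move=> sA sB BA Ax mx; apply: (length_line sA sB BA Ax) => r.
have [mr|/(local_unit noeth R_local)] := pselect (m r); [left; exact: mx|by right].
Qed.

(** A maximal submodule of finite length over B must be A, since a vector killed
    by m modulo it would enlarge it by a simple step. *)
Lemma finite_length_nilpotent A B : submodule A -> submodule B -> B `<=` A ->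
  (forall y x, m y -> A x -> exists k, B (y ^+ k *: x)) -> finite_length A B.
Proof.
move=> sA sB BA nilp.
have [||X [[[sX BX XA] flX] Xmax]] := @acc_maximal R V
    [set X | between B A X /\ finite_length X B] B accV.
- by move=> X [[]].
- by split; [split|case: (lengthxx sB)].
have [AX|nAX] := pselect (A `<=` X); first exact: finite_length_sub flX.
have [|x [Ax nXx mx]] := exists_socle sA sX _ nAX.
  by move=> y x my Ax; have [k Bk] := nilp y x my Ax; exists k; exact: BX.
have sY := submodule_add (submodule_line x) sX.
have XY : X `<=` add_sub (line x) X by apply: subset_addr; exact: submodule_line.
have [flY _] := length_line_local sY sX XY (@subset_refl _ _) mx.
case: nXx; apply: (Xmax _ _ XY); last by apply: subset_addl => //; exact: line_refl.
split; last by have [] := lengthD sY sX sB BX XY flY flX.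
split=> //; first exact: subset_trans BX XY.
by apply: add_sub_min => //; exact: line_sub.
Qed.

End LocalModules.

(** * Graded modules over a polynomial ring, as families of subquotients *)

Section Graded.
Context {R : comNzRingType} {V : lmodType R}.
Implicit Types (A B C K U : nat -> set V) (s : seq R) (a : R).

Local Notation submodules A := (forall k, submodule (A k)).

Local Notation graded_sub A B := (forall k, A k `<=` B k).

Definition stable s A : Prop :=
  forall a k x, a \in s -> A k x -> A k.+1 (a *: x).

Definition generated_from n0 s A B : Prop :=
  forall k, (n0 <= k)%N -> A k.+1 `<=` add_sub (seq_mul s (A k)) (B k.+1).

Definition finitely_generated s A B : Prop := exists n0, generated_from n0 s A B.

(** The family B + a A: the pair of A and this family is the cokernel of a on
    A / B. *)
Definition image_add a A B k : set V :=
  if k is k'.+1 then add_sub (scale_set a (A k')) (B k) else B 0%N.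

Lemma submodules_image a A B : submodules A -> submodules B ->
  submodules (image_add a A B).
Proof.
move=> sA sB [|k] /=; first exact: sB.
by apply: submodule_add; [exact: submodule_scale|exact: sB].
Qed.

Lemma image_add_sub a A B : submodules A -> graded_sub B (image_add a A B).
Proof.
move=> sA [|k] /=; first exact: subset_refl.
by apply: subset_addr; exact: submodule_scale.
Qed.

Lemma image_add_min a s A B : submodules A -> graded_sub B A -> stable (a :: s) A ->
  graded_sub (image_add a A B) A.
Proof.
move=> sA BA stA [|k] /=; first exact: BA.
apply: add_sub_min; [exact: sA| |exact: BA].
by move=> _ [x Ax <-]; apply: stA; rewrite ?mem_head.
Qed.

Lemma stable_cons a s A : stable (a :: s) A -> stable s A.
Proof. by move=> st b k x bs; apply: st; rewrite inE bs orbT. Qed.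

Lemma stable_image a s A B : submodules A -> submodules B ->
  stable (a :: s) A -> stable (a :: s) B -> stable (a :: s) (image_add a A B).
Proof.
move=> sA sB stA stB b [|k] x bs /=.
  by move=> Bx; apply: subset_addr; [exact: submodule_scale|exact: stB].
move=> [_ [y Ay <-] [z Bz <-]]; rewrite scalerDr.
exists (b *: (a *: y)); last by exists (b *: z) => //; exact: stB.
by exists (b *: y); [exact: stA|rewrite !scalerA mulrC].
Qed.

Lemma stable_seq_mul s A k N : submodule N -> submodule (A k.+1) -> stable s A ->
  N `<=` A k -> seq_mul s N `<=` A k.+1.
Proof. by move=> sN sA st NA; apply: seq_mul_min => // a x as_ /NA; exact: st. Qed.

Lemma generated_image n0 a s A B : submodules A -> submodules B ->
  generated_from n0 (a :: s) A B -> generated_from n0 s A (image_add a A B).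
Proof.
move=> sA sB gen k nk x /(gen k nk)[_ [_ [y Ay <-] [z Az <-]] [w Bw <-]].
rewrite [_ + z]addrC -addrA; exists z => //.
exists (a *: y + w) => //=; exists (a *: y); first exact: scale_setP.
by exists w.
Qed.

(** Hilbert's basis theorem for graded submodules, by induction on the number of
    variables. The submodules K : a^j increase with j, and by induction their
    images in A / a A are finitely generated and become stationary. From there on
    K : a^j itself is stationary, because a correction in a A comes from
    K : a^(j+1) in one degree less; and finite generation passes from
    K : a^(j+1) down to K : a^j, hence to K. *)
Lemma finitely_generated_sub s A B K : acc V ->
  submodules A -> submodules B -> submodules K ->
  stable s A -> stable s B -> stable s K -> graded_sub B K -> graded_sub K A ->
  finitely_generated s A B -> finitely_generated s K B.
Proof.
move=> accV; elim: s A B K => [|a s IH] A B K sA sB sK stA stB stK BK KA [n0 gen].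
  by exists n0 => k nk x /KA /(gen k nk).
pose B' := image_add a A B.
have sB' : submodules B' by exact: submodules_image.
have stB' : stable (a :: s) B' by exact: stable_image.
have BB' : graded_sub B B' by exact: image_add_sub.
have B'A : graded_sub B' A by apply: image_add_min stA => // k; exact: subset_trans (BK k) (KA k).
have fgA : finitely_generated s A B' by exists n0; exact: generated_image.
(* C j is the submodule (K : a^j) of A *)
pose C j k : set V := [set x | A k x /\ K (k + j)%N (a ^+ j *: x)].
have sC j : submodules (C j).
  by move=> k; exact: submoduleI (submodule_colon _ (sK _)).
have stC j : stable (a :: s) (C j).
  move=> b k x bs [Ax Kx]; split; first exact: stA.
  by rewrite scalerA mulrC -scalerA addSn; exact: stK.
have CA j : graded_sub (C j) A by move=> k x [].
have incC j : graded_sub (C j) (C j.+1).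
  move=> k x [Ax Kx]; split=> //; rewrite exprS -scalerA addnS.
  by apply: stK => //; exact: mem_head.
have aC j k x : C j.+1 k x -> C j k.+1 (a *: x).
  move=> [Ax Kx]; split; first by apply: stA => //; exact: mem_head.
  by rewrite scalerA -exprSr addSnnS.
have BC j : graded_sub B (C j).
  move=> k; elim: j => [|j IHj]; last exact: subset_trans IHj (incC j k).
  by move=> x Bx; split; [apply/KA/BK|rewrite expr0 scale1r addn0; exact: BK].
pose C' j k := add_sub (C j k) (B' k).
have sC' j : submodules (C' j) by move=> k; exact: submodule_add.
have stC' j : stable s (C' j).
  move=> b k _ bs [x Cx [y By <-]]; rewrite scalerDr.
  exists (b *: x); first exact: (stable_cons (stC j)).
  by exists (b *: y) => //; exact: (stable_cons stB').
have incC' j k : C' j k `<=` C' j.+1 k by apply: add_subS => //; exact: incC.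
have B'C' j : graded_sub B' (C' j) by move=> k; exact: subset_addr.
have C'A j : graded_sub (C' j) A by move=> k; apply: add_sub_min => //; exact: CA.
have fgC' j : finitely_generated s (C' j) B'.
  by apply: (IH A) => //; [exact: stable_cons stA|exact: stable_cons stB'].
(* The union of the images of the C j in A / a A is generated in degrees at
   most n1, and in each of these degrees the chain condition applies. *)
have [j0 j0P] : exists j0, forall j k, C' j k `<=` C' j0 k.
  pose U k : set V := [set x | exists j, C' j k x].
  have sU : submodules U by move=> k; exact: union_chain_submodule.
  have [n1 genU] : finitely_generated s U B'.
    apply: (IH A) => //; [exact: stable_cons stA|exact: stable_cons stB'| | |].
    - by move=> b k x bs [j Cx]; exists j; exact: stC'.
    - by move=> k x Bx; exists 0%N; exact: B'C'.
    - by move=> k x [j]; exact: C'A.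
  have [j0 j0P] : exists j0, forall k, (k <= n1)%N -> forall j, C' j k `<=` C' j0 k.
    elim: (n1) => [|n [i iP]].
      have [||//|i iP] := accV (fun j => C' j 0%N); first by move=> j; exact: sC'.
        by move=> j; exact: incC'.
      exists i => k; rewrite leqn0 => /eqP-> j x Cx.
      by apply: (iP (maxn i j) (leq_maxl _ _)); exact: (homo_chain (incC'^~ 0%N)) (leq_maxr _ _) _ Cx.
    have [||//|i' iP'] := accV (fun j => C' j n.+1); first by move=> j; exact: sC'.
      by move=> j; exact: incC'.
    exists (maxn i i') => k kn j x Cx.
    move: kn; rewrite leq_eqVlt => /predU1P[kn|/iP].
      rewrite kn in Cx *; apply: (homo_chain (incC'^~ n.+1)) (leq_maxr i i') _ _.
      apply: (iP' (maxn i' j) (leq_maxl _ _)).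
      exact: (homo_chain (incC'^~ n.+1)) (leq_maxr _ _) _ Cx.
    move=> /(_ j x Cx); exact: (homo_chain (incC'^~ k)) (leq_maxl i i') _.
  exists j0 => j k; suff Uk : U k `<=` C' j0 k by move=> x Cx; apply: Uk; exists j.
  elim: k => [|k IHk]; first by move=> x [j' /j0P]; apply.
  have [kn|nk] := leqP k.+1 n1; first by move=> x [j' /(j0P _ kn)].
  apply: subset_trans (genU k nk) _; apply: add_sub_min => //.
  exact: stable_seq_mul.
have stat k j : (j0 <= j)%N -> C j.+1 k `<=` C j k.
  elim: k j => [|k IHk] j j0j x Cx.
    have [u Cu [b Bb ub]] := j0P j.+1 0%N x (subset_addl (sB' _) Cx).
    rewrite -ub; apply: sub_add => //; last exact: BC.
    by apply: (homo_chain (incC^~ 0%N)) Cu.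
  have [u Cu [_ [_ [y Ay <-] [b Bb <-]] ub]] := j0P j.+1 k.+1 x (subset_addl (sB' _) Cx).
  have Cju : C j k.+1 u by exact: (homo_chain (incC^~ k.+1)) Cu.
  have Cjb : C j k.+1 b by exact: BC.
  rewrite -ub; apply: sub_add => //; apply: sub_add => //.
  apply: aC; apply: IHk; first exact: leqW.
  split=> //.
  have : C j.+1 k.+1 (a *: y).
    rewrite -(addrK b (a *: y)); apply: sub_sub => //; last exact: incC.
    by apply: (sub_addlK (sC _ _) (incC _ _ _ Cju)); rewrite ub.
  by case=> _; rewrite scalerA -exprSr addSnnS.
(* Generators of C j modulo a A, whose error terms are a times a vector of
   C (j + 1). *)
have split_gen j : exists n, forall k, (n <= k)%N -> forall x, C j k.+1 x ->
    exists z y b, [/\ seq_mul s (C j k) z, C j.+1 k y, B k.+1 b & x = z + (a *: y + b)].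
  have [n nP] := fgC' j; exists n => k nk x Cx.
  have [z Cz [_ [_ [y Ay <-] [b Bb <-]] zyb]] := nP k nk x (subset_addl (sB' _) Cx).
  have [z1 Cz1 [w Bw zw]] : add_sub (seq_mul s (C j k)) (B' k.+1) z.
    have [z1 Cz1 [z2 Bz2 <-]] := seq_mul_add (sC j k) (sB' k) Cz.
    exists z1 => //; exists z2 => //.
    by apply: stable_seq_mul Bz2 => //; exact: stable_cons stB'.
  case: Bw zw => _ [y1 Ay1 <-] [b1 Bb1 <-] zw.
  have xE : x = z1 + (a *: (y1 + y) + (b1 + b)).
    by rewrite -zyb -zw scalerDr -!addrA; congr (_ + (_ + _)); rewrite addrCA.
  exists z1, (y1 + y), (b1 + b); split=> //.
  - split; first exact: sub_add.
    have Cz1' : C j k.+1 z1 by apply: stable_seq_mul Cz1 => //; exact: stable_cons (stC j).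
    have : C j k.+1 (a *: (y1 + y)).
      have Cb : C j k.+1 (b1 + b) by apply: BC; exact: sub_add.
      have Cayb : C j k.+1 (a *: (y1 + y) + (b1 + b)) by apply: (sub_addlK _ Cz1'); rewrite -?xE.
      by rewrite -(addrK (b1 + b) (a *: _)); exact: sub_sub.
    by case=> _; rewrite scalerA -exprSr addSnnS.
  - exact: sub_add.
have fgC0 : finitely_generated (a :: s) (C j0) B.
  have [n nP] := split_gen j0; exists n => k nk x Cx.
  have [z [y [b [Cz Cy Bb ->]]]] := nP k nk x Cx.
  rewrite addrA; exists (z + a *: y); last by exists b.
  rewrite addrC; exists (a *: y); last by exists z.
  by exists y => //; apply: stat Cy.
have fgC_pred j : finitely_generated (a :: s) (C j.+1) B -> finitely_generated (a :: s) (C j) B.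
  move=> [n1 n1P]; have [n nP] := split_gen j; exists (maxn n n1.+1) => k.
  rewrite geq_max => /andP[nk n1k] x Cx.
  have [z [y [b [Cz Cy Bb ->]]]] := nP k nk x Cx.
  case: k n1k {nk} x Cx Cz Cy Bb => [//|k] n1k x Cx Cz Cy Bb.
  have sS := submodule_seq_mul (a :: s) (sC j k.+1).
  rewrite addrA; apply: sub_add; [exact: submodule_add| |exact: subset_addr].
  apply: sub_add; first exact: submodule_add.
    by apply: subset_addl => //; apply: subset_addr => //; exact: submodule_scale.
  have [w Cw [b' Bb' <-]] := n1P k n1k y Cy; rewrite scalerDr.
  exists (a *: w); last by exists (a *: b') => //; apply: stB; rewrite ?mem_head.
  have : scale_set a (seq_mul (a :: s) (C j.+1 k)) (a *: w) by exact: scale_setP.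
  rewrite -seq_mul_scale //; apply: seq_mulS => //.
  by move=> _ [v Cv <-]; exact: aC.
have fgK i : finitely_generated (a :: s) (C (j0 - i)%N) B.
  elim: i => [|i IHi]; first by rewrite subn0.
  have [i0|i0] := leqP j0 i; first by rewrite (_ : j0 - i.+1 = j0 - i)%N //; lia.
  by apply: fgC_pred; rewrite -subSn.
move: (fgK j0); rewrite subnn => {}fgK.
have CK k : C 0%N k = K k.
  apply/seteqP; split=> x; first by case=> _; rewrite expr0 scale1r addn0.
  by move=> Kx; split; [exact: KA|rewrite expr0 scale1r addn0].
by case: fgK => n nP; exists n => k nk; have := nP k nk; rewrite !CK.
Qed.

End Graded.
(** * Power series *)

Section Series.
Implicit Types (p q : {poly int}) (u v : nat -> int).

(** The coefficients of the product of p and the power series of u. *)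
Definition conv p u n : int := \sum_(i < n.+1) p`_i * u (n - i)%N.

Lemma conv_trunc p u n N : (n < N)%N -> conv p u n = (p * \poly_(i < N) u i)`_n.
Proof.
move=> nN; rewrite coefM; apply: eq_bigr => i _; rewrite coef_poly.
by rewrite (leq_ltn_trans (leq_subr _ _) nN).
Qed.

Lemma eq_conv p u v : u =1 v -> conv p u =1 conv p v.
Proof. by move=> uv n; apply: eq_bigr => i _; rewrite uv. Qed.

Lemma convM p q u : conv (p * q) u =1 conv p (conv q u).
Proof.
move=> n; rewrite (conv_trunc _ _ (ltnSn n)) -mulrA coefM.
apply: eq_bigr => i _; rewrite (@conv_trunc _ _ _ n.+1) //.
by rewrite ltnS leq_subr.
Qed.

Lemma convDl p q u n : conv (p + q) u n = conv p u n + conv q u n.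
Proof. by rewrite -big_split; apply: eq_bigr => i _; rewrite coefD mulrDl. Qed.

Lemma convNl p u n : conv (- p) u n = - conv p u n.
Proof. by rewrite -sumrN; apply: eq_bigr => i _; rewrite coefN mulNr. Qed.

Lemma convDr p u v n : conv p (fun k => u k + v k) n = conv p u n + conv p v n.
Proof. by rewrite -big_split; apply: eq_bigr => i _; rewrite mulrDr. Qed.

Lemma convNr p u n : conv p (fun k => - u k) n = - conv p u n.
Proof. by rewrite -sumrN; apply: eq_bigr => i _; rewrite mulrN. Qed.

Lemma convC c u n : conv c%:P u n = c * u n.
Proof.
rewrite /conv big_ord_recl subn0 coefC eqxx big1 ?addr0 // => i _.
by rewrite coefC mul0r.
Qed.

Lemma conv1 u n : conv 1 u n = u n.
Proof. by rewrite (convC 1) mul1r. Qed.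

Lemma convX u n : conv 'X u n = if n is k.+1 then u k else 0.
Proof.
case: n => [|n]; first by rewrite /conv big_ord1 coefX mul0r.
rewrite /conv 2!big_ord_recl big1 => [|i _]; last by rewrite coefX mul0r.
by rewrite !coefX /= mul0r add0r mul1r addr0 subSS subn0.
Qed.

Lemma conv_1X u n : conv (1 - 'X) u n = u n - (if n is k.+1 then u k else 0).
Proof. by rewrite convDl convNl conv1 convX. Qed.

Lemma conv_1X_sum u n : conv (1 - 'X) (fun k => \sum_(j < k.+1) u j) n = u n.
Proof.
rewrite conv_1X; case: n => [|n]; first by rewrite big_ord1 subr0.
by rewrite big_ord_recr /= addrAC subrr add0r.
Qed.

Lemma conv_1X_inj e u v : conv ((1 - 'X) ^+ e) u =1 conv ((1 - 'X) ^+ e) v -> u =1 v.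
Proof.
elim: e u v => [|e IH] u v uv; first by move=> n; rewrite -(conv1 u) -(conv1 v) uv.
have {uv} uv n : conv (1 - 'X) u n = conv (1 - 'X) v n.
  by apply: IH => k; rewrite -!convM -!exprSr uv.
elim=> [|n IHn]; first by have := uv 0%N; rewrite !conv_1X !subr0.
by have := uv n.+1; rewrite !conv_1X IHn => /subIr.
Qed.

Lemma Posz_sum n (f : nat -> nat) :
  (\sum_(i < n) f i)%N%:Z = \sum_(i < n) (f i)%:Z.
Proof. exact: (big_morph Posz PoszD (erefl 0%:Z)). Qed.

(** The coefficients of 1 / (1 - T)^r. *)
Fixpoint beta (r n : nat) : nat :=
  if r is r'.+1 then (\sum_(j < n.+1) beta r' j)%N else (n == 0%N).

Notation betaz r := (fun n => (beta r n)%:Z).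

Lemma conv_1X_beta r e n : (e <= r)%N ->
  conv ((1 - 'X) ^+ e) (betaz r) n = (beta (r - e) n)%:Z.
Proof.
elim: e r n => [|e IH] r n er; first by rewrite subn0 conv1.
rewrite exprS convM (eq_conv _ (fun k => IH r k (ltnW er))).
rewrite -(conv_1X_sum (betaz (r - e.+1)%N)) /= -subnSK //.
by apply: eq_conv => k; rewrite Posz_sum.
Qed.

Lemma conv_delta p n : conv p (betaz 0) n = p`_n.
Proof.
rewrite /conv big_ord_recr /= subnn mulr1 big1 ?add0r // => i _.
by rewrite subn_eq0 leqNgt ltn_ord mulr0.
Qed.

Lemma conv_1X_solve e u p : (forall n, conv ((1 - 'X) ^+ e) u n = p`_n) ->
  u =1 conv p (betaz e).
Proof.
move=> up; apply: (conv_1X_inj (e := e)) => n; rewrite up -convM mulrC convM.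
rewrite -(conv_delta p); apply: eq_conv => k.
by rewrite conv_1X_beta // subnn.
Qed.

Lemma beta_recr r n : beta r.+1 n.+1 = (beta r.+1 n + beta r n.+1)%N.
Proof. by rewrite /= big_ord_recr. Qed.

Lemma beta_bin e n : beta e.+1 n = 'C(n + e, e).
Proof.
elim: e n => [|e IH]; elim=> [|n IHn].
- by rewrite /= big_ord1.
- by rewrite beta_recr IHn /= !bin0 addn0.
- by rewrite /= big_ord1 -/(beta e.+1 0) IH !add0n !binn.
- by rewrite beta_recr IHn IH addnS binS addSn addnS.
Qed.

Lemma beta_homo e i j : (0 < e)%N -> (i <= j)%N -> (beta e i <= beta e j)%N.
Proof. by case: e => // e _ ij; rewrite !beta_bin leq_bin2l // leq_add2r. Qed.

Lemma beta_unbounded e c : exists n, (c * beta e.+1 n < beta e.+2 n)%N.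
Proof.
exists (c * e.+1)%N; rewrite !beta_bin; set n := (c * e.+1)%N.
rewrite -(ltn_pmul2l (ltn0Sn e)) addnS -mul_bin_diag mulnA [(e.+1 * c)%N]mulnC.
rewrite ltn_pmul2r ?bin_gt0 ?leq_addl //= -/n.
by rewrite ltnS leq_addr.
Qed.

Lemma leq_sum_support (f : nat -> nat) n N : (forall i, (N <= i)%N -> f i = 0%N) ->
  (\sum_(i < n) f i <= \sum_(i < N) f i)%N.
Proof.
move=> f0; rewrite -!(big_mkord xpredT f).
have [nN|Nn] := leqP n N; first by rewrite [leqRHS](big_cat_nat (leq0n _) nN) //= leq_addr.
rewrite (big_cat_nat (leq0n _) (ltnW Nn)) //= [X in (_ + X)%N](_ : _ = 0%N) ?addn0 //.
by rewrite big_nat_cond big1 // => i /andP[/andP[Ni _] _]; exact: f0.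
Qed.

Lemma norm_conv_beta p e : (0 < e)%N ->
  exists c : nat, forall n, `|conv p (betaz e) n| <= (c * beta e n)%:Z.
Proof.
move=> e0; exists (\sum_(i < size p) absz (p`_i)%R)%N => n.
apply: le_trans (ler_norm_sum _ _ _) _.
apply: (@le_trans _ _ (\sum_(i < n.+1) (absz (p`_i)%R * beta e n)%:Z)).
  apply: ler_sum => i _; rewrite normrM PoszM abszE ler_wpM2l //.
  by rewrite lez_nat beta_homo // leq_subr.
rewrite -(Posz_sum _ (fun i => absz (p`_i)%R * beta e n)%N) -big_distrl /= lez_nat leq_mul2r.
apply/orP; right.
apply: (leq_sum_support (f := fun i => absz (p`_i)%R)) => i pi.
by rewrite nth_default.
Qed.

Lemma factor_1X p : p.[1] = 0 -> exists q, p = (1 - 'X) * q.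
Proof.
move=> /eqP/factor_theorem[q ->]; exists (- q).
by rewrite polyC1 mulrN -mulNr opprB mulrC.
Qed.

(** The difference p - p(1) is divisible by 1 - T, which lowers the order of the
    pole at 1 by one. *)
Lemma conv_beta_asymptotic p e : exists c : nat, forall n,
  `|conv p (betaz e.+2) n - p.[1] * (beta e.+2 n)%:Z| <= (c * beta e.+1 n)%:Z.
Proof.
have [|q pq] := @factor_1X (p - p.[1]%:P); first by rewrite !hornerE subrr.
have [c cP] := norm_conv_beta q (ltn0Sn e); exists c => n; apply: le_trans (cP n).
have -> : conv p (betaz e.+2) n - p.[1] * (beta e.+2 n)%:Z =
    conv (p - p.[1]%:P) (betaz e.+2) n by rewrite convDl convNl convC.
rewrite pq mulrC convM (eq_conv _ (v := betaz e.+1)) // => k.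
by rewrite -[1 - 'X]expr1 conv_1X_beta // subn1.
Qed.

Lemma conv_beta_ge0 p e : (forall n, 0 <= conv p (betaz e.+2) n) -> 0 <= p.[1].
Proof.
move=> p0; rewrite leNgt; apply/negP => p1.
have [c cP] := conv_beta_asymptotic p e; have [n nP] := beta_unbounded e c.
have := cP n; have := p0 n; move: (conv _ _ n) p1 nP => x p1 nP x0.
have : p.[1] <= -1 by lia.
move: (beta _ _) (beta _ _) nP => b b' nP; move: p.[1] => y; nia.
Qed.

Lemma conv_beta_le0 p e c :
  (forall n, conv p (betaz e.+2) n <= (c * beta e.+1 n)%:Z) -> p.[1] <= 0.
Proof.
move=> p0; rewrite leNgt; apply/negP => p1.
have [c' cP] := conv_beta_asymptotic p e; have [n nP] := beta_unbounded e (c + c').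
have := cP n; have := p0 n; move: (conv _ _ n) p1 nP => x p1 nP x0.
have : 1 <= p.[1] by lia.
move: (beta _ _) (beta _ _) nP x0 => b b' nP x0; move: p.[1] => y; nia.
Qed.

Lemma beta_leS r n : (0 < r)%N -> (beta r n <= beta r.+1 n)%N.
Proof. by case: r => // r _; case: n => [|n]; rewrite ?beta_recr ?leq_addl //= !big_ord1. Qed.

Lemma conv_factor p e : conv ((1 - 'X) * p) (betaz e.+1) =1 conv p (betaz e).
Proof.
move=> n; rewrite mulrC convM; apply: eq_conv => k.
by rewrite -[1 - 'X]expr1 conv_1X_beta // subn1.
Qed.

(** The value at 1 of a numerator is the leading coefficient of the growth of the
    series. A nonnegative series that grows like 1 / (1 - T)^d therefore has a pole
    of order at most d, and the surviving numerator w has w(1) >= 0. *)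
Lemma small_series_numerator d p (G : nat -> nat) c : (2 <= d)%N ->
  (forall n, conv ((1 - 'X) ^+ d.+2) (fun k => (G k)%:Z) n = p`_n) ->
  (forall n, G n <= c * beta d n)%N ->
  exists2 w, p = (1 - 'X) * ((1 - 'X) * w) & 0 <= w.[1].
Proof.
case: d => [|[|d]] // _ Gp Gc.
have {}Gp := conv_1X_solve Gp.
have [|p1 p1E] := @factor_1X p.
  apply/eqP; rewrite eq_le (@conv_beta_ge0 _ d.+2) ?andbT => [|n]; last by rewrite -Gp.
  apply: (@conv_beta_le0 _ d.+2 c) => n; rewrite -Gp lez_nat.
  by apply: leq_trans (Gc n) _; rewrite leq_mul2l beta_leS ?orbT.
have {}Gp n : (G n)%:Z = conv p1 (betaz d.+3) n by rewrite Gp p1E conv_factor.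
have [|w wE] := @factor_1X p1.
  apply/eqP; rewrite eq_le (@conv_beta_ge0 _ d.+1) ?andbT => [|n]; last by rewrite -Gp.
  by apply: (@conv_beta_le0 _ d.+1 c) => n; rewrite -Gp lez_nat.
exists w; first by rewrite -wE.
by apply: (@conv_beta_ge0 _ d) => n; rewrite -conv_factor -wE -Gp.
Qed.

(** Both identities are the Taylor expansion of p at 1 up to order two. *)
Lemma second_coef_diff p q (rho w : {poly int}) :
  q - p - (1 - 'X) * rho = (1 - 'X) * ((1 - 'X) * w) ->
  q.[1] = p.[1] /\ p^`N(2).[1] - q^`N(2).[1] = rho^`().[1] - w.[1].
Proof.
move=> E; have pE : p = q - (1 - 'X) * (rho + (1 - 'X) * w) by rewrite mulrDr -E; ring.
split; first by rewrite pE !hornerE; ring.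
have two f : f^`N(2).[1] *+ 2 = f^`()^`().[1] :> int.
  by rewrite -hornerMn -(nderivn_def 2 f) derivnS derivn1.
apply: (@pmulrnI _ 2) => //; rewrite mulrnBl !two pE.
rewrite !derivE !(hornerD, hornerN, hornerM, hornerX, hornerC).
ring.
Qed.

End Series.
Notation betaz r := (fun n => (beta r n)%:Z).
(** * Hilbert functions of graded modules *)

Section HilbertFunctions.
Context {R : comNzRingType} {V : lmodType R}.
Implicit Types (A B C K : nat -> set V) (s : seq R) (a : R).

Local Notation submodules A := (forall k, submodule (A k)).
Local Notation graded_sub A B := (forall k, A k `<=` B k).
Local Notation finite_lengths A B := (forall k, finite_length (A k) (B k)).
Local Notation lengths A B := (fun k => (length (A k) (B k))%:Z).

Lemma length_sub0 (X Y : set V) : submodule X -> X `<=` Y -> Y `<=` X -> length X Y = 0%N.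
Proof.
by move=> sX XY YX; rewrite (_ : Y = X); [case: (lengthxx sX)|apply/seteqP].
Qed.

(** Multiplication by a has a finitely generated kernel K and cokernel C over the
    remaining variables, and (1 - T) times the Hilbert series of A / B is the
    series of C minus T times the series of K. *)
Lemma hilbert_serre s A B : acc V -> submodules A -> submodules B ->
  graded_sub B A -> stable s A -> stable s B -> finitely_generated s A B ->
  finite_lengths A B ->
  exists h : {poly int}, forall n, conv ((1 - 'X) ^+ size s) (lengths A B) n = h`_n.
Proof.
move=> accV; elim: s A B => [|a s IH] A B sA sB BA stA stB fg fl.
  have [n0 gen] := fg.
  exists (\poly_(i < n0.+1) (length (A i) (B i))%:Z) => n; rewrite conv1 coef_poly.
  case: ltnP => // n0n; case: n n0n => // n n0n.
  by rewrite length_sub0 // => x /(gen n n0n)[y -> [z Bz <-]]; rewrite add0r.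
pose K k := A k `&` colon (B k.+1) a.
have sK : submodules K by move=> k; exact: submoduleI (submodule_colon _ (sB _)).
have BK : graded_sub B K.
  by move=> k x Bx; split; [exact: BA|apply: stB => //; exact: mem_head].
have KA : graded_sub K A by move=> k x [].
pose C := image_add a A B.
have sC : submodules C by exact: submodules_image.
have BC : graded_sub B C by exact: image_add_sub.
have CA : graded_sub C A by exact: image_add_min stA.
have [||||hC hCP] := IH A C sA sC CA.
- exact: stable_cons stA.
- exact: stable_cons (stable_image sA sB stA stB).
- by have [n gen] := fg; exists n; exact: generated_image.
- by move=> k; apply: finite_length_sub (fl k).
have stK : stable (a :: s) K.
  move=> b k x bs [Ax Bx]; split; first exact: stA.
  by rewrite /colon /= scalerA mulrC -scalerA; exact: stB.
have [||||hK hKP] := IH K B sK sB BK.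
- exact: stable_cons stK.
- exact: stable_cons stB.
- have [n gen] := finitely_generated_sub accV sA sB sK stA stB stK BK KA fg.
  exists n => k nk x /(gen k nk)[_ [_ [y [_ By] <-] [z Kz <-]] [w Bw <-]].
  rewrite [_ + z]addrC -addrA; exists z => //; exists (a *: y + w) => //.
  exact: sub_add.
- by move=> k; apply: finite_length_sub (fl k).
exists (hC - 'X * hK) => n; rewrite coefB coefXM exprSr convM.
pose u := lengths A C; pose v := lengths K B.
rewrite (eq_conv _ (v := fun k => u k + - conv 'X v k)); last first.
  move=> [|k]; rewrite conv_1X convX; first by [].
  have flB k' : finite_length (C k') (B k') by apply: finite_length_sub (fl k').
  have flC k' : finite_length (A k') (C k') by apply: finite_length_sub (fl k').
  have [_ ->] := lengthD (sA k.+1) (sC k.+1) (sB k.+1) (BC _) (CA _) (flC _) (flB _).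
  have [flK lK] := length_scale (sA k) (sB k.+1) (flB k.+1).
  have flKB : finite_length (K k) (B k) by apply: finite_length_sub (fl k).
  have [_ ->] := lengthD (sA k) (sK k) (sB k) (BK _) (KA _) flK flKB.
  by rewrite /= lK /u /v /= !PoszD; ring.
rewrite convDr convNr hCP; congr (_ - _).
by rewrite -convM mulrC convM convX; case: n.
Qed.

(** * Cyclic graded modules *)

Lemma sum_triangle (f : nat -> nat -> nat) k :
  (\sum_(n < k.+1) \sum_(j < n.+1) f j (n - j) =
   \sum_(j < k.+1) \sum_(l < (k - j).+1) f j l)%N.
Proof.
elim: k => [|k IH]; first by rewrite !big_ord1.
rewrite big_ord_recr /= IH [RHS]big_ord_recr [in X in (_ + X)%N]big_ord_recr /= subnn.
rewrite big_ord1 addnA -big_split /=; congr (_ + _)%N.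
by apply: eq_bigr => j _; rewrite subSn ?[RHS]big_ord_recr // -ltnS.
Qed.

Lemma sum_rev (f : nat -> nat) k : (\sum_(j < k.+1) f (k - j) = \sum_(j < k.+1) f j)%N.
Proof. by rewrite (reindex_inj rev_ord_inj); apply: eq_bigr => j _ /=; rewrite subSS subKn // -ltnS. Qed.

Lemma sum_ltn_le j n : (\sum_(i < n) (i < j) <= j)%N.
Proof.
suff -> : (\sum_(i < n) (i < j) = minn n j)%N by exact: geq_minr.
elim: n => [|n IH]; first by rewrite big_ord0 min0n.
by rewrite big_ord_recr /= IH; lia.
Qed.

Variable m : set R.
Hypothesis noeth : noetherian_ring R.
Hypothesis R_local : local_ring m.

Lemma stable_exp a s A i j x : stable (a :: s) A -> A i x -> A (i + j)%N (a ^+ j *: x).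
Proof.
move=> st Ax; elim: j => [|j IH]; first by rewrite addn0 expr0 scale1r.
by rewrite addnS exprS -scalerA; apply: st => //; exact: mem_head.
Qed.

(** A cyclic module over polynomials with coefficients in the residue field is
    either free or grows more slowly. Filtering it by the powers of the variable a
    gives cyclic modules over the other variables, each a quotient of the one
    before; as soon as one of them is not free, its slower growth bounds all later
    ones. The growth is measured by partial sums, so that the bound has the same
    form for every number of variables, including zero and one. *)
Lemma cyclic_hilbert s A B x : submodules A -> submodules B -> graded_sub B A ->
  stable s A -> stable s B -> generated_from 0 s A B ->
  A 0%N `<=` add_sub (line x) (B 0%N) -> (forall y, m y -> B 0%N (y *: x)) ->
  finite_lengths A B ->
  (forall k, length (A k) (B k) <= beta (size s) k)%N /\
  ((forall k, length (A k) (B k) = beta (size s) k) \/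
   exists c, forall k, (\sum_(j < k.+1) length (A j) (B j) <= c * beta (size s) k)%N).
Proof.
elim: s A B x => [|a s IH] A B x sA sB BA stA stB gen A0x mx fl.
  have [_ l0] := length_line_local noeth R_local (sA _) (sB _) (BA _) A0x mx.
  have lS k : length (A k.+1) (B k.+1) = 0%N.
    by rewrite length_sub0 // => y /(gen k isT)[z -> [w Bw <-]]; rewrite add0r.
  split; first by case=> [|k] //=; rewrite lS.
  move: l0; rewrite leq_eqVlt => /predU1P[l1|]; [left|rewrite ltnS leqn0 => /eqP l0; right].
    by case=> [|k] /=; [exact: l1|exact: lS].
  by exists 0%N => k; rewrite big_ord_recl l0 big1 // => i _; exact: lS.
(* W j is a^j A + B, so that W j / W (j + 1) is killed by a, and is generated by
   a^j x in degree j over the other variables. *)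
pose W j k := if (j <= k)%N then add_sub (scale_set (a ^+ j) (A (k - j)%N)) (B k) else B k.
have sW j : submodules (W j).
  by move=> k; rewrite /W; case: ifP => // _; apply: submodule_add => //; exact: submodule_scale.
have BW j : graded_sub B (W j).
  move=> k; rewrite /W; case: ifP => _; last exact: subset_refl.
  by apply: subset_addr; exact: submodule_scale.
have inW i j y : A i y -> W j (i + j)%N (a ^+ j *: y).
  move=> Ay; rewrite /W leq_addl addnK; apply: subset_addl => //; exact: scale_setP.
have WP j k (N : set V) : submodule N -> B k `<=` N ->
    (forall i y, k = (i + j)%N -> A i y -> N (a ^+ j *: y)) -> W j k `<=` N.
  move=> sN BN AN; rewrite /W; case: ifP => // jk; apply: add_sub_min => //.
  by move=> _ [y Ay <-]; apply: AN Ay; rewrite subnK.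
have WA j : graded_sub (W j) A.
  by move=> k; apply: WP => // i y -> Ay; exact: (stable_exp (s := s)).
have WS j : graded_sub (W j.+1) (W j).
  move=> k; apply: WP => // i y -> Ay.
  by rewrite exprSr -scalerA addnS -addSn; apply: inW; apply: stA => //; exact: mem_head.
have W0 k : W 0%N k = A k.
  apply/seteqP; split; first exact: WA.
  by move=> y Ay; have := @inW k 0%N y Ay; rewrite addn0 expr0 scale1r.
have Wlast k : W k.+1 k = B k by rewrite /W ltnn.
have stW j : stable (a :: s) (W j).
  move=> b k y bs; move: y; suff : W j k `<=` colon (W j k.+1) b by [].
  apply: WP; first exact: submodule_colon.
    by move=> y By; apply: BW; exact: stB.
  move=> i y -> Ay; rewrite /colon /= scalerA mulrC -scalerA -addSn.
  by apply: inW; exact: stA.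
have flW j k : finite_length (W j k) (W j.+1 k).
  by apply: finite_length_sub (fl k); [exact: BW|exact: WA].
pose g j l := length (W j (l + j)%N) (W j.+1 (l + j)%N).
have lE k : length (A k) (B k) = (\sum_(j < k.+1) g j (k - j))%N.
  have [||_] := @length_telescope R V (fun j => W j k) k.+1 (fun j => sW j k); first by move=> j _; exact: WS.
    by move=> j _; exact: flW.
  rewrite W0 Wlast => ->; apply: eq_bigr => j _.
  by rewrite /g subnK // -ltnS.
have gP j := IH (fun l => W j (l + j)%N) (fun l => W j.+1 (l + j)%N) (a ^+ j *: x).
have {IH} gP j : (forall l, g j l <= beta (size s) l)%N /\
    ((forall l, g j l = beta (size s) l) \/
     exists c, forall k, (\sum_(l < k.+1) g j l <= c * beta (size s) k)%N).
  apply: gP.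
  - by move=> l; exact: sW.
  - by move=> l; exact: sW.
  - by move=> l; exact: WS.
  - by move=> b l y bs; apply: (stable_cons (stW j)).
  - by move=> b l y bs; apply: (stable_cons (stW j.+1)).
  - move=> l _; apply: WP; first exact: submodule_add (submodule_seq_mul _ (sW _ _)) (sW _ _).
      by move=> y By; apply: subset_addr; [exact: submodule_seq_mul|exact: BW].
    move=> i y /addIn<- Ay.
    have [_ [_ [u Au <-] [z Az <-]] [w Bw <-]] := gen l isT y Ay.
    rewrite [_ + z]addrC -addrA scalerDr; exists (a ^+ j *: z).
      have : scale_set (a ^+ j) (seq_mul s (A l)) (a ^+ j *: z) by exact: scale_setP.
      rewrite -seq_mul_scale //; apply: seq_mulS => // _ [v Av <-]; exact: inW.
    exists (a ^+ j *: (a *: u + w)) => //; rewrite scalerDr; apply: sub_add => //.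
      by rewrite scalerA -exprSr addSnnS; exact: inW.
    by apply: BW; exact: (stable_exp (s := s)).
  - rewrite add0n; apply: WP; first exact: submodule_add (submodule_line _) (sW _ _).
      by move=> y By; apply: subset_addr; [exact: submodule_line|exact: BW].
    move=> i y; rewrite -[LHS]add0n => /addIn<- /A0x[_ [r _ <-] [b Bb <-]].
    rewrite scalerDr scalerA mulrC -scalerA; exists (r *: (a ^+ j *: x)); first by exists r.
    exists (a ^+ j *: b) => //; apply: BW.
    by have := @stable_exp a s B 0%N j b stB Bb; rewrite add0n.
  - move=> y my; rewrite add0n Wlast scalerA mulrC -scalerA.
    by have := @stable_exp a s B 0%N j _ stB (mx y my); rewrite add0n.
  - by move=> l; exact: flW.
have gle i j l : (g (i + j) l <= g j l)%N.
  apply: (@length_scale_le R V (a ^+ i)) => //; try exact: WS.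
  - apply: finite_length_sub (fl (l + (i + j))%N); first exact: BW.
    apply: add_sub_min => // _ [y Wy <-].
    rewrite (addnC i) addnA.
    exact: (@stable_exp a s A (l + j)%N i y stA (WA j _ _ Wy)).
  - move=> _ [y + <-]; move: y.
    suff : W j.+1 (l + j)%N `<=` colon (W (i + j).+1 (l + (i + j))%N) (a ^+ i) by [].
    apply: WP; first exact: submodule_colon.
      move=> y By; apply: BW; rewrite (addnC i) addnA.
      exact: (@stable_exp a s B (l + j)%N i y stB By).
    move=> k y E Ay; rewrite /colon /= scalerA -exprD addnS.
    by rewrite (_ : l + (i + j) = k + (i + j).+1)%N; [exact: inW|lia].
  - apply: WP; first exact: submodule_add (submodule_scale _ (sW _ _)) (sW _ _).
      by move=> y By; apply: subset_addr; [exact: submodule_scale|exact: BW].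
    move=> k y /addIn<- Ay; rewrite exprD -scalerA.
    by apply: subset_addl => //; apply: scale_setP; exact: inW.
have betaE k : (\sum_(j < k.+1) beta (size s) (k - j) = beta (size (a :: s)) k)%N.
  exact: (sum_rev (beta (size s))).
split.
  by move=> k; rewrite lE -betaE; apply: leq_sum => j _; case: (gP j).
have [free|/existsNP[j /existsNP[l gjl]]] := pselect (forall j l, g j l = beta (size s) l).
  by left=> k; rewrite lE -betaE; apply: eq_bigr => j _; exact: free.
right; have [_ [/(_ l)//|[c cP]]] := gP j.
exists (j + c)%N => k.
rewrite (eq_bigr (fun n : 'I__ => \sum_(i < n.+1) g i (n - i)))%N; last by move=> n _; exact: lE.
have cE : (c * beta (size (a :: s)) k = \sum_(i < k.+1) c * beta (size s) (k - i))%N.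
  by rewrite -betaE big_distrr.
rewrite sum_triangle mulnDl cE.
apply: (@leq_trans (\sum_(i < k.+1) ((i < j) * beta (size (a :: s)) k + c * beta (size s) (k - i))))%N.
  apply: leq_sum => i _; case: ltnP => ij.
    rewrite mul1n (leq_trans _ (leq_addr _ _)) //.
    apply: leq_trans (@beta_homo (size (a :: s)) (k - i) k isT (leq_subr _ _)).
    by apply: leq_sum => i' _; case: (gP i).
  rewrite mul0n add0n; apply: leq_trans (cP _).
  by apply: leq_sum => i' _; rewrite -{1}(subnK ij); exact: gle.
rewrite big_split leq_add2r -big_distrl leq_mul2r; apply/orP; right.
exact: sum_ltn_le.
Qed.

(** Adding to B the submodules generated by one vector killed by m at a time
    filters A / B by at most length (A 0) (B 0) cyclic modules over the residue
    field. Here r counts the free ones, and g collects the others. As g is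
    nonnegative, the second coefficient of the Hilbert polynomial of a module
    generated in degree 0 can only deviate from that of a free module in one
    direction. *)
Lemma generated_hilbert s A B : acc V -> submodules A -> submodules B -> graded_sub B A ->
  stable s A -> stable s B -> generated_from 0 s A B -> finite_lengths A B ->
  (forall y x, m y -> A 0%N x -> exists k, B 0%N (y ^+ k *: x)) ->
  exists r g c, [/\ (r <= length (A 0%N) (B 0%N))%N,
    forall k, length (A k) (B k) = (r * beta (size s) k + g k)%N &
    forall k, (\sum_(j < k.+1) g j <= c * beta (size s) k)%N].
Proof.
move=> accV sA sB BA stA stB gen fl nilp.
have [n ln] : exists n, (length (A 0%N) (B 0%N) <= n)%N by exists (length (A 0%N) (B 0%N)).
elim: n B ln sB BA stB gen fl nilp => [|n IH] B ln sB BA stB gen fl nilp.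
  have l0 : length (A 0%N) (B 0%N) = 0%N by apply/eqP; rewrite -leqn0.
  have AB k : A k `<=` B k.
    elim: k => [|k IHk]; first exact: (length_eq0 (fl 0%N) (sA _) (sB _) (BA _) l0).
    apply: subset_trans (gen k isT) _; apply: add_sub_min => //.
    exact: stable_seq_mul.
  exists 0%N, (fun=> 0%N), 0%N; split=> // k; last by rewrite big1.
  by rewrite length_sub0.
have [AB|nAB] := pselect (A 0%N `<=` B 0%N).
  have [|r [g [c [r0 lE gc]]]] := IH B _ sB BA stB gen fl nilp; first by rewrite length_sub0.
  by exists r, g, c; split=> //; apply: leq_trans r0 _.
have [x [Ax nBx mx]] := exists_socle noeth (sA _) (sB _) nilp nAB.
pose C := fix C k := if k is k'.+1 then add_sub (seq_mul s (C k')) (B k)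
  else add_sub (line x) (B 0%N).
have sC : submodules C.
  elim=> [|k IHk] /=; apply: submodule_add => //; first exact: submodule_line.
  exact: submodule_seq_mul.
have BC : graded_sub B C.
  by case=> [|k] /=; apply: subset_addr; [exact: submodule_line|exact: submodule_seq_mul].
have CA : graded_sub C A.
  elim=> [|k IHk] /=; apply: add_sub_min => //; first exact: line_sub.
  exact: stable_seq_mul.
have stC : stable s C.
  by move=> b k y bs Cy /=; apply: subset_addl => //; exact: seq_mul_mem.
have flC : finite_lengths A C by move=> k; apply: finite_length_sub (fl k).
have flB : finite_lengths C B by move=> k; apply: finite_length_sub (fl k).
have lD k : length (A k) (B k) = (length (A k) (C k) + length (C k) (B k))%N.
  by have [_ ->] := lengthD (sA k) (sC k) (sB k) (BC k) (CA k) (flC k) (flB k).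
have C0 : (0 < length (C 0%N) (B 0%N))%N.
  rewrite lt0n; apply/eqP => l0; apply: nBx.
  by apply: (length_eq0 (flB 0%N) (sC _) (sB _) (BC _) l0); apply: subset_addl => //; exact: line_refl.
have [||||r [g [c [rl lE gc]]]] := IH C _ sC CA stC.
- by move: ln; rewrite lD; lia.
- move=> k _; apply: subset_trans (gen k isT) _; apply: add_subS => //; exact: BC.
- exact: flC.
- by move=> y z my Az; have [k Bk] := nilp y z my Az; exists k; exact: BC.
have genC : generated_from 0 s C B by move=> k _ y.
have [_ dich] := cyclic_hilbert sC sB BC stC stB genC (@subset_refl _ _) mx flB.
case: dich => [free|[c' c'P]].
  exists r.+1, g, c; split=> // [|k]; first by rewrite lD; lia.
  by rewrite lD lE free mulSn; lia.
exists r, (fun k => g k + length (C k) (B k))%N, (c + c')%N; split=> [|k|k].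
- by rewrite lD; lia.
- by rewrite lD lE addnA.
- by rewrite big_split mulnDl leq_add.
Qed.

End HilbertFunctions.
(** * Superficial sequences *)

Section Superficial.
Context {R : comNzRingType}.
Variable m : set R.
Hypothesis noeth : noetherian_ring R.
Hypothesis R_local : local_ring m.
Context {V : lmodType R}.
Hypothesis accV : acc V.
Variables (q : set R) (F : nat -> set V).
Hypothesis q_primary : primary_to m q.
Hypothesis F_good : good_filtration q F.
Implicit Types (N : set V) (a b : R) (P Q : set R).

Local Notation ideal I := (@submodule R R^o I).

Lemma primary_ideal : ideal q.
Proof. by case: q_primary => /proper_idealrP[]. Qed.

Lemma primary_sub : q `<=` m.
Proof. by case: q_primary => _ _ <- x qx; exists 1%N; rewrite expr1. Qed.

Lemma primary_radical y : m y -> exists k, q (y ^+ k).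
Proof. by case: q_primary => _ _ <-. Qed.

Lemma primary_generators : exists t : seq R, ideal_span [set` t] = q.
Proof. exact: noeth primary_ideal. Qed.

Lemma filtration_sub n : submodule (F n).
Proof. by case: F_good => -[]. Qed.

Lemma filtration_homo i j : (i <= j)%N -> F j `<=` F i.
Proof.
move=> /subnK<-; elim: (j - i)%N => [|k IH]; first exact: subset_refl.
by rewrite addSn; apply: subset_trans IH; case: F_good => -[].
Qed.

Lemma filtration_mul b k x : q b -> F k x -> F k.+1 (b *: x).
Proof.
move=> qb Fx; case: F_good => -[_ _ _ qF] _; apply: qF.
by apply: span_sub; exists b => //; exists x.
Qed.

Lemma filtration_exp b j k x : q b -> F k x -> F (k + j)%N (b ^+ j *: x).
Proof.
move=> qb Fx; elim: j => [|j IH]; first by rewrite addn0 expr0 scale1r.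
by rewrite addnS exprS -scalerA; exact: filtration_mul.
Qed.

Lemma filtration_radical y j k : m y ->
  exists e, forall x, F k x -> F (k + j)%N (y ^+ e *: x).
Proof.
move=> /primary_radical[i qi]; exists (i * j)%N => x Fx.
by rewrite exprM; exact: filtration_exp.
Qed.

Section Quotient.
Variables (N : set V) (t : seq R).
Hypothesis sN : submodule N.
Hypothesis tq : ideal_span [set` t] = q.

Local Notation G := (quot_filtration F N).

Lemma mem_generators b : b \in t -> q b.
Proof. by move=> bt; rewrite -tq => I [_]; apply. Qed.

Lemma quot_submodule k : submodule (G k).
Proof. by apply: submodule_add => //; exact: filtration_sub. Qed.

Lemma quot_sub k : N `<=` G k.
Proof. by apply: subset_addr; exact: filtration_sub. Qed.

Lemma quot_homo i j : (i <= j)%N -> G j `<=` G i.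
Proof. by move=> ij; apply: add_subS => //; exact: filtration_homo. Qed.

Lemma quot_stable : stable t G.
Proof.
move=> b k _ bt [x Fx [y Ny <-]]; rewrite scalerDr; exists (b *: x).
  by apply: filtration_mul => //; exact: mem_generators.
by exists (b *: y) => //; exact: sub_scale.
Qed.

Lemma quot_finitely_generated : finitely_generated t G (fun=> N).
Proof.
case: F_good => _ [n0 n0P]; exists n0 => k nk _ [x + [y Ny <-]].
rewrite -(n0P k nk) -tq ideal_mul_span; last exact: filtration_sub.
move=> Fx; exists x; last by exists y.
apply: seq_mulS Fx; first exact: quot_submodule.
by apply: subset_addl.
Qed.

Lemma const_stable : stable t (fun=> N).
Proof. by move=> b k x _; exact: sub_scale. Qed.

(** The Artin-Rees lemma: the filtration induced on E is again good modulo N, by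
    the basis theorem applied to the Rees module of G. *)
Lemma artin_rees E : submodule E -> N `<=` E ->
  finitely_generated t (fun k => G k `&` E) (fun=> N).
Proof.
move=> sE NE; apply: (finitely_generated_sub accV (A := G)).
- exact: quot_submodule.
- by [].
- by move=> k; apply: submoduleI => //; exact: quot_submodule.
- exact: quot_stable.
- exact: const_stable.
- by move=> b k x bt [Gx Ex]; split; [exact: quot_stable|exact: sub_scale].
- by move=> k x Nx; split; [exact: quot_sub|exact: NE].
- by move=> k x [].
- exact: quot_finitely_generated.
Qed.

Variable a : R.
Hypothesis a_superficial : superficial q G a.

(** By superficiality the intersection lies in every later term of the filtration,
    so that it vanishes modulo N by Krull's intersection theorem. *)
Lemma superficial_colon : exists c, colon N a `&` G c `<=` N.
Proof.
have [_ [c cP]] := a_superficial; exists c.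
pose E := colon N a `&` G c.
have sE : submodule E by apply: submoduleI; [exact: submodule_colon|exact: quot_submodule].
have NE : N `<=` E by move=> x Nx; split; [exact: sub_scale|exact: quot_sub].
have EG k : (c <= k)%N -> E `<=` G k.
  elim: k => [|k IH] ck x Ex; first by move: Ex => [_]; apply: quot_homo.
  move: ck; rewrite leq_eqVlt => /predU1P[ck|ck]; first by rewrite -ck; case: Ex.
  rewrite -(cP k.+1) ?(ltnW ck) //; case: (Ex) => Nax Gx; split=> //.
  by rewrite /colon /=; apply: quot_sub.
have [n nP] := artin_rees sE NE.
apply: (nakayama noeth R_local accV (t := t)) => //.
  by move=> b bt; apply: primary_sub; exact: mem_generators.
move=> x Ex; have [|y Gy [z Nz yz]] := nP (maxn n c) (leq_maxl _ _) x.
  by split=> //; apply: EG => //; apply: leqW; exact: leq_maxr.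
exists y; last by exists z.
by apply: seq_mulS Gy => // u [].
Qed.

(** By Artin-Rees, the vectors of a V + N in a far term of the filtration are of
    the form a z modulo N with z in the term G c where superficiality applies, and
    it moves z to the expected term. *)
Lemma superficial_image : exists n1, forall n, (n1 <= n)%N ->
  G n.+1 `&` add_sub (scale_set a setT) N `<=` add_sub (scale_set a (F n)) N.
Proof.
have [_ [c cP]] := a_superficial.
pose E := add_sub (scale_set a [set: V]) N.
have sE : submodule E by apply: submodule_add => //; apply: submodule_scale; exact: submoduleT.
have [|n nP] := artin_rees sE; first by apply: subset_addr; apply: submodule_scale; exact: submoduleT.
have saF k : submodule (scale_set a (F k)) by apply: submodule_scale; exact: filtration_sub.
have KP k : G (n + k)%N `&` E `<=` add_sub (scale_set a (F k)) N.
  elim: k => [|k IH].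
    by case: F_good => -[-> _ _ _] _ x [].
  rewrite addnS; apply: subset_trans (nP _ (leq_addr _ _)) _.
  apply: add_sub_min; [exact: submodule_add| |exact: subset_addr].
  apply: seq_mul_min; first exact: submodule_add.
  move=> b x bt /IH[_ [y Fy <-] [z Nz <-]]; rewrite scalerDr scalerA mulrC -scalerA.
  exists (a *: (b *: y)).
    by apply: scale_setP; apply: filtration_mul => //; exact: mem_generators.
  by exists (b *: z) => //; exact: sub_scale.
exists (n + c)%N => k nck x [Gx Ex].
have kE : k.+1 = (n + (k.+1 - n))%N by lia.
have [_ [z Fz <-] [w Nw azw]] : add_sub (scale_set a (F (k.+1 - n)%N)) N x.
  by apply: KP; rewrite -kE.
have : G k z.
  rewrite -cP; last by lia.
  split; last by apply: subset_addl => //; apply: filtration_homo Fz; lia.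
  rewrite /colon /= -(addrK w (a *: z)) azw.
  by apply: sub_sub; [exact: quot_submodule| |exact: quot_sub].
case=> f Ff [w' Nw' fw']; rewrite -azw -fw' scalerDr -addrA.
exists (a *: f); first exact: scale_setP.
by exists (a *: w' + w) => //; apply: sub_add => //; exact: sub_scale.
Qed.

(** A superficial element lies in no minimal prime of the support of V / N other
    than m, so that V / (a V + N) has smaller dimension. If P were minimal, some
    sg a^n with sg outside P would kill V / N; for b in q outside P, powers of b
    absorb the factors a one at a time, leaving a multiplier outside P that kills
    V / N. *)
Lemma superficial_prime P : prime_idealr P -> P <> m ->
  [set r | forall x, add_sub (scale_set a setT) N (r *: x)] `<=` P ->
  exists Q, [/\ prime_idealr Q, [set r | forall x, N (r *: x)] `<=` Q & Q `<` P].
Proof.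
move=> pP Pm annP; have [sP P1 PP] := prime_idealrP pP.
have sM : submodule (scale_set a [set: V]) by apply: submodule_scale; exact: submoduleT.
have Pa : P a by apply: annP => x; apply: subset_addl => //; exact: scale_setP.
have [b qb nPb] : exists2 b, q b & ~ P b.
  apply: contrapT => nb; apply: Pm; case: R_local => -[_ mmax] _; apply: mmax.
    by case: pP.
  move=> y /primary_radical[k qk]; apply: (prime_exp (n := k)) => //.
  by apply: contrapT => nP; apply: nb; exists (y ^+ k).
have [c cP] := superficial_colon.
have descend n sg : (forall x, N ((sg * a ^+ n) *: x)) ->
    forall x, N ((b ^+ (c * n) * sg) *: x).
  elim: n sg => [|n IH] sg Nsg x.
    by rewrite muln0 expr0 mul1r; have := Nsg x; rewrite expr0 mulr1.
  rewrite mulnS addnC exprD -mulrA; apply: IH => y.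
  rewrite -mulrA -scalerA; apply: cP; split.
    rewrite /colon /=.
    have -> : a *: (b ^+ c *: ((sg * a ^+ n) *: y)) = b ^+ c *: ((sg * a ^+ n.+1) *: y).
      by rewrite !scalerA exprSr; congr (_ *: _); ring.
    exact: sub_scale.
  apply: subset_addl => //.
  have := @filtration_exp b c 0%N ((sg * a ^+ n) *: y) qb; rewrite add0n; apply.
  by case: F_good => -[-> _ _ _].
pose S : set R := [set r | exists sg n, ~ P sg /\ r = sg * a ^+ n].
have sA : ideal [set r | forall x, N (r *: x)].
  apply/submoduleP; split; first by move=> x; rewrite scale0r; exact: sub_0.
  move=> r u v Nu Nv x; rewrite scalerDl.
  have -> : (r *: u) *: x = r *: ((u : R) *: x) by rewrite scalerA.
  exact: sub_add sN (sub_scale r sN (Nu x)) (Nv x).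
have [||| Q [pQ annQ QS]] := @prime_avoiding R noeth _ S sA.
- by exists 1, 0%N; rewrite expr0 mulr1.
- move=> _ _ [u [i [nu ->]]] [v [j [nv ->]]]; exists (u * v), (i + j)%N; split.
    by move=> /PP[].
  by rewrite exprD mulrACA.
- move=> r Nr [sg [n [nsg rE]]].
  have : P (b ^+ (c * n) * sg).
    apply: annP => x; apply: subset_addr => //.
    by apply: descend => y; rewrite -rE.
  by move=> /PP[/(prime_exp pP)|].
exists Q; split=> //; split.
  move=> x Qx; apply: contrapT => nPx; apply: (QS x Qx).
  by exists x, 0%N; rewrite expr0 mulr1.
move=> /(_ a Pa) Qa; apply: (QS a Qa).
by exists 1, 1%N; rewrite expr1 mul1r.
Qed.

End Quotient.

Lemma seq_mul_rcons (s : seq R) a (A : set V) : submodule A ->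
  seq_mul (rcons s a) A = add_sub (scale_set a A) (seq_mul s A).
Proof.
move=> sA; have saA := submodule_scale a sA; have ssA := submodule_seq_mul s sA.
apply/seteqP; split.
  apply: seq_mul_min => [|b x]; first exact: submodule_add.
  rewrite mem_rcons inE => /predU1P[->|bs] Ax.
    by apply: subset_addl => //; exact: scale_setP.
  by apply: subset_addr => //; exact: seq_mul_mem.
apply: add_sub_min; first exact: submodule_seq_mul.
  by move=> _ [x Ax <-]; apply: seq_mul_mem => //; rewrite mem_rcons mem_head.
apply: seq_mul_min => [|b x bs Ax]; first exact: submodule_seq_mul.
by apply: seq_mul_mem => //; rewrite mem_rcons inE bs orbT.
Qed.

Section Sequence.
Variable s : seq R.
Hypothesis s_superficial : superficial_seq q F s.

Local Notation N i := (seq_mul (take i s) [set: V]).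

Lemma submodule_take i : submodule (N i).
Proof. exact/submodule_seq_mul/submoduleT. Qed.

Lemma take_succ i : (i < size s)%N -> N i.+1 = add_sub (scale_set s`_i setT) (N i).
Proof. by move=> is_; rewrite (take_nth 0) // seq_mul_rcons //; exact: submoduleT. Qed.

Lemma superficial_take i : (i < size s)%N -> superficial q (quot_filtration F (N i)) s`_i.
Proof.
by move=> /s_superficial; rewrite ideal_mul_span //; exact: submoduleT.
Qed.

Lemma superficial_mem a : a \in s -> q a.
Proof. by move=> /(nthP 0)[i is_ <-]; have [] := s_superficial is_. Qed.

(** Each element of the sequence allows one more step down from P. *)
Lemma superficial_prime_chain i P : (i <= size s)%N -> prime_idealr P -> P <> m ->
  [set r | forall x, N i (r *: x)] `<=` P ->
  exists C : nat -> set R,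
    [/\ forall j, (j <= i)%N -> prime_idealr (C j) /\ annihilator V `<=` C j,
        forall j, (j < i)%N -> C j `<` C j.+1 & C i = P].
Proof.
have [t tq] := primary_generators.
elim: i P => [|i IH] P is_ pP Pm annP.
  exists (fun=> P); split=> // j _; split=> // r rV; apply: annP => x.
  by rewrite rV take0.
have [|Q [pQ annQ [QP nPQ]]] := superficial_prime (submodule_take i) tq (superficial_take is_) pP Pm.
  by rewrite -take_succ.
have Qm : Q <> m.
  move=> Qm; apply: nPQ; rewrite Qm; have [sP P1 _] := prime_idealrP pP.
  exact: proper_sub_local.
have [C [Cprime Clt CQ]] := IH Q (ltnW is_) pQ Qm annQ.
exists (fun j => if (j <= i)%N then C j else P); split=> [j|j|]; last by rewrite ltnn.
  case: (leqP j i) => [ji _|ij _]; first exact: Cprime.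
  split=> //; apply: subset_trans QP; rewrite -CQ.
  by have [] := Cprime i (leqnn i).
rewrite ltnS => ji; rewrite ji; case: (ltnP j i) => [|ij]; first exact: Clt.
by rewrite (_ : j = i) ?CQ //; lia.
Qed.

Hypothesis s_maximal : size s = kdim V.
Hypothesis dim_gt0 : (0 < kdim V)%N.

(** Otherwise the chain of primes ending at P, with m put on top of it, would be
    longer than the dimension. *)
Lemma support_reduction P : prime_idealr P ->
  [set r | forall x : V, seq_mul s setT (r *: x)] `<=` P -> P = m.
Proof.
move=> pP annP; apply: contrapT => Pm.
have [|C [Cprime Clt CP]] := @superficial_prime_chain (size s) P (leqnn _) pP Pm.
  by rewrite take_size.
have [sm m1] := local_proper R_local; have [sP P1 _] := prime_idealrP pP.
have Plt : P `<` m.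
  have Psm : P `<=` m by exact: proper_sub_local.
  by split=> // mP; apply: Pm; apply/seteqP.
have annC : annihilator V `<=` P by rewrite -CP; case: (Cprime (size s)).
have pm : prime_idealr m.
  split; first exact/proper_idealrP.
  move=> u v /set_mem muv; apply/orP.
  have [mu|/(local_unit noeth R_local)[u' u'u]] := pselect (m u); [left|right]; apply: mem_set => //.
  by rewrite -[v]mul1r -u'u -mulrA; exact: idealM.
pose D := chain_lengths [set Q | prime_idealr Q /\ annihilator V `<=` Q].
have Dlong : D (kdim V).+1.
  exists (fun j => if (j <= kdim V)%N then C j else m); rewrite -s_maximal; split=> j.
    case: (leqP j (size s)) => [ji _|_ _]; first exact: Cprime.
    by split=> //; apply: subset_trans annC _; case: Plt.
  rewrite ltnS => ji; rewrite ji; case: (ltnP j (size s)) => [|ij]; first exact: Clt.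
  by rewrite (_ : j = size s) ?CP //; lia.
have [[_ [n Dn]]|noD] := pselect (has_sup D); last first.
  by move: dim_gt0; rewrite /kdim supremum_out.
have [_ /(_ _ Dlong)] := nat_supremumP Dn Dlong.
by rewrite /Order.le /= ltnn.
Qed.

Lemma quotient_nilpotent y : m y -> exists k, forall x : V, seq_mul s setT (y ^+ k *: x).
Proof.
move=> my; apply: contrapT => nk.
have sJ := submodule_seq_mul s (@submoduleT R V).
pose I : set R := [set r | forall x : V, seq_mul s setT (r *: x)].
have sI : ideal I.
  apply/submoduleP; split; first by move=> x; rewrite scale0r; exact: sub_0.
  move=> r u v Nu Nv x; rewrite scalerDl.
  have -> : (r *: u) *: x = r *: ((u : R) *: x) by rewrite scalerA.
  exact: sub_add sJ (sub_scale r sJ (Nu x)) (Nv x).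
have [||| Q [pQ IQ QS]] := @prime_avoiding R noeth I [set r | exists k, r = y ^+ k] sI.
- by exists 0%N; rewrite expr0.
- by move=> _ _ [i ->] [j ->]; exists (i + j)%N; rewrite exprD.
- by move=> r Ir [k rk]; apply: nk; exists k; rewrite -rk.
apply: (QS y); last by exists 1%N; rewrite expr1.
by rewrite (support_reduction pQ IQ).
Qed.

(** As V / J V has finite length, the images of the F n in it are eventually
    constant, so that they vanish by Nakayama's lemma. *)
Lemma filtration_sub_reduction : exists n1, forall n, (n1 <= n)%N ->
  F n `<=` seq_mul s setT.
Proof.
have [t tq] := primary_generators.
set N' := seq_mul s _; have sN : submodule N' := submodule_seq_mul s (@submoduleT R V).
have sG := quot_submodule sN; pose G := quot_filtration F N'.
have flT : finite_length [set: V] N'.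
  apply: (finite_length_nilpotent noeth R_local accV) => //; first exact: submoduleT.
  by move=> y x /quotient_nilpotent[k kP] _; exists k; exact: kP.
have fl n : finite_length (G n) N' by apply: finite_length_sub flT.
have [n0 n0P] := quot_finitely_generated sN tq.
pose p v := `[< exists n, (n0 <= n)%N /\ length (G n) N' = v >].
have exp : exists v, p v by exists (length (G n0) N'); apply/asboolP; exists n0.
case: (ex_minnP exp) => v /asboolP[n [nn nv]] vmin; exists n => k nk.
suff GN : G n `<=` N'.
  by move=> x /(filtration_homo nk) Fx; apply: GN; apply: subset_addl.
have NG i : N' `<=` G i by exact: quot_sub.
have GG : G n.+1 `<=` G n by exact: quot_homo.
have flG : finite_length (G n) (G n.+1) by apply: finite_length_sub (fl n).
have [_ lD] := lengthD (sG n) (sG n.+1) sN (NG _) GG flG (fl _).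
have vle : (v <= length (G n.+1) N')%N.
  by apply: vmin; apply/asboolP; exists n.+1; split=> //; exact: leqW.
have l0 : length (G n) (G n.+1) = 0%N.
  apply/eqP; rewrite -leqn0 -(leq_add2r (length (G n.+1) N')) add0n.
  by rewrite -lD [leqLHS]nv.
apply: (nakayama noeth R_local accV (t := t)) => //.
  by move=> b bt; apply: primary_sub; exact: (mem_generators tq).
exact: subset_trans (length_eq0 flG (sG _) (sG _) GG l0) (n0P n nn).
Qed.

(** An ideal generated by a maximal superficial sequence is a reduction. A vector
    of F (n + 1) is first written in J V = (a_1, ..., a_d) V; by superficiality of
    a_d, ..., a_1, in this order, the coefficient of each a_i can be taken in
    F n. *)
Lemma reduction : exists n1, forall n, (n1 <= n)%N -> F n.+1 `<=` seq_mul s (F n).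
Proof.
have [t tq] := primary_generators.
have sJF n : submodule (seq_mul s (F n)) by apply: submodule_seq_mul; exact: filtration_sub.
have JF n : seq_mul s (F n) `<=` F n.+1.
  apply: seq_mul_min; first exact: filtration_sub.
  by move=> b x /superficial_mem; exact: filtration_mul.
have down j : (j <= size s)%N -> exists n1, forall n, (n1 <= n)%N ->
    F n.+1 `<=` add_sub (seq_mul s (F n)) (N (size s - j)).
  elim: j => [_|j IH js].
    have [n1 n1P] := filtration_sub_reduction; exists n1 => n nn x Fx.
    apply: subset_addr => //; rewrite subn0 take_size; apply: n1P Fx; exact: leqW.
  have [n1 n1P] := IH (ltnW js).
  pose i := (size s - j.+1)%N; have iE : (size s - j = i.+1)%N by rewrite /i; lia.
  have is_ : (i < size s)%N by rewrite /i; lia.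
  have sNi := submodule_take i.
  have [n2 n2P] := superficial_image sNi tq (superficial_take is_).
  exists (maxn n1 n2) => n; rewrite geq_max => /andP[nn1 nn2] x Fx.
  have := n1P n nn1 x Fx; rewrite iE (take_succ is_) => -[y Jy [w Nw ywx]].
  have Fw : F n.+1 w.
    by apply: (sub_addlK (filtration_sub _) (JF _ _ Jy)); rewrite ywx.
  have [|_ [f Ff <-] [z Nz fzw]] := n2P n nn2 w.
    by split=> //; apply: subset_addl.
  exists (y + s`_i *: f); last by exists z => //; rewrite -addrA fzw.
  apply: sub_add => //; apply: seq_mul_mem => //; [exact: filtration_sub|exact: mem_nth].
have [n1 n1P] := down (size s) (leqnn _); exists n1 => n nn.
apply: subset_trans (n1P n nn) _; apply: add_sub_min => //.
by rewrite subnn take0 => _ ->; exact: sub_0.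
Qed.

End Sequence.

End Superficial.
(** * Comparison of the two filtrations *)

Section Comparison.
Context {R : comNzRingType} {V : lmodType R}.
Implicit Types (A B X Y : set V) (s : seq R).

Lemma submodule_iter s X n : submodule X -> submodule (iter n (seq_mul s) X).
Proof. by move=> sX; elim: n => [//|n IH]; exact: submodule_seq_mul. Qed.

Lemma iter_seq_mulS s X Y n : submodule Y -> X `<=` Y ->
  iter n (seq_mul s) X `<=` iter n (seq_mul s) Y.
Proof.
move=> sY XY; elim: n => [//|n IH] /=; apply: seq_mulS => //.
exact: submodule_iter.
Qed.

Lemma iter_seq_mul_colon s X Y r n : submodule X -> submodule Y -> X `<=` colon Y r ->
  iter n (seq_mul s) X `<=` colon (iter n (seq_mul s) Y) r.
Proof.
move=> sX sY XY; elim: n => [//|n IH] /=.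
have sI := submodule_iter s n sY.
apply: seq_mul_min; first exact/submodule_colon/submodule_seq_mul.
move=> a x as_ /IH Yx; rewrite /colon /= scalerA mulrC -scalerA.
exact: seq_mul_mem.
Qed.

Lemma adic_seq_mul s n : adic (ideal_span [set` s]) V n = iter n (seq_mul s) [set: V].
Proof.
rewrite /adic; elim: n => [//|n IH]; rewrite !iterS IH ideal_mul_span //.
exact/submodule_iter/submoduleT.
Qed.

(** A series determines its numerator; when the latter vanishes at 1 there is no
    numerator in the sense of the definition, and the default value 0 remains. *)
Lemma hilbert_numeratorE (F : nat -> set V) (h : {poly int}) :
  (forall n, conv ((1 - 'X) ^+ kdim V) (fun k => (hilbert_fun F k)%:Z) n = h`_n) ->
  hilbert_numerator F = if h.[1] == 0 then 0 else h.
Proof.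
move=> hP; have uniq h' : is_hilbert_numerator F h' -> h' = h.
  by case=> h'P _; apply/polyP => n; rewrite h'P -hP.
rewrite /hilbert_numerator; case: xgetP => [h' _ Ph'|noh].
  by rewrite (uniq _ Ph'); case: (Ph') => _; rewrite (uniq _ Ph') => /negbTE->.
case: eqP => // /eqP h1; case: (noh h); split=> // n.
by rewrite -hP.
Qed.

Variable m : set R.
Hypothesis noeth : noetherian_ring R.
Hypothesis R_local : local_ring m.
Hypothesis accV : acc V.
Variables (q : set R) (F : nat -> set V).
Hypothesis q_primary : primary_to m q.
Hypothesis F_good : good_filtration q F.
Variable s : seq R.
Hypothesis sq : {in s, forall a, q a}.
Variable n1 : nat.
Hypothesis redF : forall n, (n1 <= n)%N -> F n.+1 `<=` seq_mul s (F n).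

Local Notation N n := (iter n (seq_mul s) [set: V]).
Local Notation sF := (filtration_sub F_good).

Let sJ X n : submodule X -> submodule (iter n (seq_mul s) X) := submodule_iter s n.
Let sN n : submodule (N n) := submodule_iter s n (@submoduleT R V).

Lemma filtration0 : F 0%N = setT.
Proof. by case: F_good => -[]. Qed.

Lemma seq_mul_filtration n : seq_mul s (F n) `<=` F n.+1.
Proof.
apply: seq_mul_min => [|b x bs]; first exact: sF.
exact: (filtration_mul F_good (sq bs)).
Qed.

(** A power of y carries F i into F (i + n1 + 1), which equals J F (i + n1). *)
Lemma filtration_nilpotent y i : m y ->
  exists e, forall x, F i x -> seq_mul s (F i) (y ^+ e *: x).
Proof.
move=> my; have [e eP] := filtration_radical q_primary F_good n1.+1 i my.
exists e => x /eP; rewrite addnS => /redF; rewrite leq_addl => /(_ isT).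
by apply: seq_mulS; [exact: sF|apply: (filtration_homo F_good); exact: leq_addr].
Qed.

(** For fixed i, the modules J^k F (i + 1) / J^(k + 1) F i form a graded module
    over polynomials in the generators of J, generated in degree k = 0. *)
Local Notation LA i k := (iter k (seq_mul s) (F i.+1)).
Local Notation LB i k := (iter k (seq_mul s) (seq_mul s (F i))).

Let sJF i : submodule (seq_mul s (F i)) := submodule_seq_mul s (sF i).

Lemma piece_sub i k : LB i k `<=` LA i k.
Proof. by apply: iter_seq_mulS; [exact: sF|exact: seq_mul_filtration]. Qed.

Lemma piece_finite i k : finite_length (LA i k) (LB i k).
Proof.
apply: (finite_length_nilpotent noeth R_local accV); [exact: sJ (sF _)|exact: sJ (sJF i)|exact: piece_sub|].
move=> y x my Ax; have [e eP] := filtration_nilpotent i my; exists e.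
apply: (iter_seq_mul_colon (sF i.+1) (sJF i)) Ax => z Fz; apply: eP.
exact: (filtration_homo F_good (leqnSn i)).
Qed.

Lemma piece_hilbert i : exists t : nat * (nat -> nat) * nat,
  [/\ (t.1.1 <= length (F i.+1) (seq_mul s (F i)))%N,
    forall k, length (LA i k) (LB i k) = (t.1.1 * beta (size s) k + t.1.2 k)%N &
    forall k, (\sum_(j < k.+1) t.1.2 j <= t.2 * beta (size s) k)%N].
Proof.
have st X : submodule X -> stable s (fun k => iter k (seq_mul s) X).
  by move=> sX a k x as_ Xx /=; apply: seq_mul_mem => //; exact: sJ sX.
have [||||||||r [g [c rP]]] := @generated_hilbert R V m noeth R_local s
    (fun k => LA i k) (fun k => LB i k) accV.
- by move=> k; exact: sJ (sF _).
- by move=> k; exact: sJ (sJF i).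
- exact: piece_sub.
- exact: st (sF _).
- exact: st (sJF i).
- by move=> k _; apply: subset_addl; exact: sJ (sJF i).
- exact: piece_finite.
- move=> y x my Fx; have [e eP] := filtration_nilpotent i my; exists e.
  by apply: eP; exact: (filtration_homo F_good (leqnSn i)).
by exists (r, g, c).
Qed.

(** The chain F (n + 1), J F n, J^2 F (n - 1), ..., J^(n + 1) F 0. *)
Lemma length_pieces n : finite_length (F n.+1) (N n.+1) /\
  length (F n.+1) (N n.+1) = (\sum_(i < n.+1) length (LA i (n - i)) (LB i (n - i)))%N.
Proof.
pose U k := iter k (seq_mul s) (F (n.+1 - k)%N).
have UE k : (k < n.+1)%N -> U k = LA (n - k)%N k /\ U k.+1 = LB (n - k)%N k.
  by move=> kn; rewrite /U subSS iterSr subSn // -ltnS.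
have [|||fl lE] := @length_telescope R V U n.+1.
- by move=> k; apply: sJ; exact: sF.
- by move=> k /UE[-> ->]; exact: piece_sub.
- by move=> k /UE[-> ->]; exact: piece_finite.
move: fl lE; rewrite /U subn0 subnn filtration0 /= => fl lE; split=> //.
rewrite lE -(sum_rev (fun i => length (LA i (n - i)) (LB i (n - i)))).
apply: eq_bigr => k _; have [|E1 E2] := UE k; first exact: ltn_ord.
by rewrite -/(U k) E1 -[X in length _ X]/(U k.+1) E2 subKn // -ltnS.
Qed.

Lemma filtration_finite n : finite_length (F n) (F n.+1).
Proof.
apply: (finite_length_nilpotent noeth R_local accV (sF n) (sF n.+1)).
  exact: (filtration_homo F_good (leqnSn n)).
move=> y x my; have [e eP] := filtration_nilpotent n my; exists e.
by apply: seq_mul_filtration; exact: eP.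
Qed.

Lemma adic_decreasing n : N n.+1 `<=` N n.
Proof. exact: seq_mul_sub (sN n). Qed.

Lemma adic_finite n : finite_length (N n) (N n.+1).
Proof.
apply: (finite_length_nilpotent noeth R_local accV (sN n) (sN n.+1) (@adic_decreasing n)).
move=> y x my Nx; have [e eP] := filtration_nilpotent 0 my; exists e.
rewrite iterSr; apply: (iter_seq_mul_colon (@submoduleT R V)) Nx.
  exact/submodule_seq_mul/submoduleT.
by move=> z _; rewrite /colon /= -filtration0; apply: eP; rewrite filtration0.
Qed.

Lemma hilbert_sums n :
  (\sum_(k < n.+1) hilbert_fun (fun n => N n) k =
   \sum_(k < n.+1) hilbert_fun F k +
   \sum_(i < n.+1) length (LA i (n - i)) (LB i (n - i)))%N.
Proof.
have [flD <-] := length_pieces n.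
have [||flF lF] := @length_telescope R V F n.+1 sF.
- by move=> k _; exact: (filtration_homo F_good (leqnSn k)).
- by move=> k _; exact: filtration_finite.
have [||flN lN] := @length_telescope R V (fun n => N n) n.+1 sN.
- by move=> k _; exact: adic_decreasing.
- by move=> k _; exact: adic_finite.
rewrite -lF -lN; rewrite filtration0 in flF *.
have NF : N n.+1 `<=` F n.+1.
  elim: (n.+1) => [|k IH]; first by rewrite filtration0.
  by apply: subset_trans (seq_mul_filtration (n := k)); apply: seq_mulS => //; exact: sF.
by have [_] := lengthD (@submoduleT R V) (sF n.+1) (sN n.+1) NF (@subsetT _ _) flF flD.
Qed.

Lemma filtration_hilbert_serre : exists h : {poly int}, forall n,
  conv ((1 - 'X) ^+ size s) (fun k => (hilbert_fun F k)%:Z) n = h`_n.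
Proof.
apply: (hilbert_serre (A := F) (B := fun k => F k.+1) accV).
- exact: sF.
- by move=> k; exact: sF.
- by move=> k; exact: (filtration_homo F_good (leqnSn k)).
- by move=> a k x /sq; exact: filtration_mul.
- by move=> a k x /sq; exact: filtration_mul.
- by exists n1 => k nk; apply: subset_trans (redF nk) _; apply: subset_addl; exact: sF.
- exact: filtration_finite.
Qed.

Lemma adic_hilbert_serre : exists h : {poly int}, forall n,
  conv ((1 - 'X) ^+ size s) (fun k => (hilbert_fun (fun n => N n) k)%:Z) n = h`_n.
Proof.
apply: (hilbert_serre (A := fun n => N n) (B := fun k => N k.+1) accV).
- exact: sN.
- by move=> k; exact: sN.
- exact: adic_decreasing.
- by move=> a k x as_ Nx; exact: (seq_mul_mem (sN k)).
- by move=> a k x as_ Nx; exact: (seq_mul_mem (sN k.+1)).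
- by exists 0%N => k _; exact: (subset_addl (sN k.+2)).
- exact: adic_finite.
Qed.

Hypothesis s_size : size s = kdim V.
Hypothesis dim_ge2 : (2 <= kdim V)%N.

(** The i-th graded module of pieces contributes r i free modules shifted by i,
    and a remainder g i of smaller growth. With rho = sum_i r_i T^i, this gives
    h_N - h_F = (1 - T) rho + (1 - T)^2 w with w(1) >= 0, so that the difference
    of second coefficients is rho'(1) - w(1), where r i is at most the length of
    F (i + 1) / J F i. *)
Lemma second_coef_bound :
  hilbert_coef F 2 - hilbert_coef (fun n => N n) 2 <=
  \sum_(i < n1) (i * length (F i.+1) (seq_mul s (F i)))%:Z.
Proof.
pose d := size s.
have [hF hFP] := filtration_hilbert_serre; have [hN hNP] := adic_hilbert_serre.
have [t tP] := boolp.choice piece_hilbert.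
pose r i := (t i).1.1; pose g i := (t i).1.2; pose c i := (t i).2.
have rv i : (r i <= length (F i.+1) (seq_mul s (F i)))%N by case: (tP i).
have lE i k : length (LA i k) (LB i k) = (r i * beta d k + g i k)%N by case: (tP i).
have gc i k : (\sum_(j < k.+1) g i j <= c i * beta d k)%N by case: (tP i).
have late i : (n1 <= i)%N -> seq_mul s (F i) = F i.+1.
  by move=> /redF ?; apply/seteqP; split=> //; exact: seq_mul_filtration.
have r0 i : (n1 <= i)%N -> r i = 0%N.
  by move=> ni; apply/eqP; have := rv i; rewrite late // (lengthxx (sF _)).2 leqn0.
have g0 i k : (n1 <= i)%N -> g i k = 0%N.
  move=> ni; have := lE i k; rewrite late // (lengthxx (sJ k (sF _))).2.
  by move/esym/eqP; rewrite addn_eq0 => /andP[_ /eqP].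
pose gt n := (\sum_(i < n.+1) g i (n - i))%N.
pose G n := (\sum_(j < n.+1) gt j)%N.
have d2 : (2 <= d)%N by rewrite /d s_size.
have GP n : (G n <= (\sum_(i < n1) c i) * beta d n)%N.
  rewrite /G /gt sum_triangle big_distrl /=.
  pose f i := (if i < n1 then c i * beta d n else 0)%N.
  have -> : (\sum_(i < n1) c i * beta d n = \sum_(i < n1) f i)%N.
    by apply: eq_bigr => i _; rewrite /f ltn_ord.
  apply: leq_trans (@leq_sum_support f n.+1 n1 _); last by move=> i; rewrite /f leqNgt => /negbTE->.
  apply: leq_sum => i _; rewrite /f; case: ltnP => ni; last first.
    by rewrite big1 // => l _; rewrite g0.
  apply: leq_trans (gc i _) _; rewrite leq_mul2l beta_homo ?orbT ?leq_subr //.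
  exact: leq_trans d2.
pose rho : {poly int} := \poly_(i < n1) (r i)%:Z.
have rhoE i : rho`_i = (r i)%:Z by rewrite coef_poly; case: ltnP => // /r0->.
have Gp n : conv ((1 - 'X) ^+ d.+2) (fun k => (G k)%:Z) n = (hN - hF - (1 - 'X) * rho)`_n.
  pose sN' k := \sum_(j < k.+1) (hilbert_fun (fun n => N n) j)%:Z.
  pose sF' k := \sum_(j < k.+1) (hilbert_fun F j)%:Z.
  rewrite exprSr convM (eq_conv _ (v := fun k => sN' k + - (sF' k + conv rho (betaz d) k))); last first.
    move=> k; rewrite -[RHS]/(_ - _).
    have -> : conv (1 - 'X) (fun k => (G k)%:Z) k = (gt k)%:Z.
      rewrite -(conv_1X_sum (fun j => (gt j)%:Z)); apply: eq_conv => j.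
      exact: Posz_sum.
    have lsum : (\sum_(i < k.+1) length (LA i (k - i)) (LB i (k - i)) =
        \sum_(i < k.+1) r i * beta d (k - i) + gt k)%N.
      by rewrite -big_split; apply: eq_bigr => i _; exact: lE.
    have rsum : conv rho (betaz d) k = (\sum_(i < k.+1) r i * beta d (k - i))%N%:Z.
      rewrite (Posz_sum _ (fun i => r i * beta d (k - i))%N).
      by apply: eq_bigr => i _; rewrite rhoE PoszM.
    rewrite /sN' /sF' rsum -!Posz_sum hilbert_sums lsum !PoszD; ring.
  rewrite convDr convNr convDr exprSr !convM !coefB -addrA -opprD; congr (_ - (_ + _)).
  - rewrite -hNP; apply: eq_conv => k.
    exact: (conv_1X_sum (fun j => (hilbert_fun (fun n => N n) j)%:Z)).
  - rewrite -hFP; apply: eq_conv => k.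
    exact: (conv_1X_sum (fun j => (hilbert_fun F j)%:Z)).
  rewrite -!convM -mulrA [_ ^+ d * _]mulrC convM -conv_delta; apply: eq_conv => k.
  by rewrite conv_1X_beta // subnn.
have [w pE w0] := small_series_numerator d2 Gp GP.
have [h1 h2] := second_coef_diff pE.
rewrite /hilbert_coef (@hilbert_numeratorE F hF) -?s_size //.
rewrite (@hilbert_numeratorE _ hN) -?s_size // h1.
(* Here h_F(1) = h_N(1) = 0, and both numerators are the default 0. *)
case: eqP => _.
  rewrite linear0 horner0 subr0; apply: sumr_ge0 => i _; exact: le0z_nat.
rewrite h2; apply: (@le_trans _ _ rho^`().[1]); first by rewrite gerBl.
rewrite /rho poly_def raddf_sum horner_sum; apply: ler_sum => i _.
rewrite [X in X.[_]]derivZ derivXn hornerZ hornerMn hornerXn expr1n natz -PoszM lez_nat mulnC.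
by rewrite leq_mul2l rv orbT.
Qed.

End Comparison.
Theorem theorem2 (R : comNzRingType) (m q : set R)
    (R_noetherian : noetherian_ring R) (R_local : local_ring m)
    (residue_infinite : infinite_set (residue_field m))
    (q_primary : primary_to m q)
    (M : lmodType R) (M_fg : fg_module M) (dim_ge2 : (2 <= kdim M)%N)
    (F : nat -> set M) (F_good : good_filtration q F)
    (s : seq R) (s_superficial : superficial_seq q F s)
    (s_maximal : size s = kdim M)
    (J : set R) (J_gen : J = ideal_span [set` s])
    (depth_ge : (kdim M - 1 <= gr_depth m J M)%N) :
  hilbert_coef F 2 - hilbert_coef (adic J M) 2 <=
    \sum_(n \in [set n : nat | (1 <= n)%N])
      (n * length (F n.+1) (ideal_mul J (F n)))%:Z.
Proof.
have accM := fg_acc R_noetherian M_fg.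
have sF := filtration_sub F_good.
have sq : {in s, forall a, q a} := superficial_mem s_superficial.
have [n1 redF] := reduction R_noetherian R_local accM q_primary F_good s_superficial
  s_maximal (ltnW dim_ge2).
have sum_fin : \sum_(n \in [set n : nat | (1 <= n)%N])
      (n * length (F n.+1) (ideal_mul J (F n)))%:Z =
    \sum_(i < n1) (i * length (F i.+1) (seq_mul s (F i)))%:Z.
  have mulE n : ideal_mul J (F n) = seq_mul s (F n) by rewrite J_gen ideal_mul_span.
  under eq_fsbigr do rewrite mulE.
  rewrite (fsbigE (index_iota 1 n1)) ?iota_uniq //.
  - rewrite -(big_mkord xpredT (fun i => (i * length (F i.+1) (seq_mul s (F i)))%:Z)).
    rewrite [LHS]big_seq_cond [LHS](eq_bigl (fun i => i \in index_iota 1 n1)); last first.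
      move=> i; rewrite mem_index_iota; apply/andb_idr => /andP[i0 _]; exact: mem_set.
    rewrite -big_seq; case: (n1) => [|n]; first by rewrite !big_geq.
    by rewrite [RHS]big_ltn // mul0n add0r.
  - by move=> n /=; rewrite mem_index_iota => /andP[].
  - move=> n /= n0; rewrite mem_index_iota n0 /= -leqNgt => nn.
    have -> : seq_mul s (F n) = F n.+1.
      by apply/seteqP; split; [exact: (seq_mul_filtration F_good sq)|exact: redF].
    by rewrite (lengthxx (sF _)).2 muln0.
have -> : adic J M = (fun n => iter n (seq_mul s) [set: M]).
  by apply/funext => n; rewrite J_gen adic_seq_mul.
rewrite sum_fin.
exact: (second_coef_bound R_noetherian R_local accM q_primary F_good sq redF s_maximal).
Qed.
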